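(* There exist numerical constants $C_1,C_2,C_3,C_4>0$ such that the following holds. Let $x_0\in\mathbb{R}^n$ with $\|x_0\|_2=1$, let $a_1,\dots,a_m\sim\mathcal N(0,I_n)$ be independent, let $y_i=f(\langle a_i,x_0\rangle)\in\mathcal Y$, $i=1,\dots,m$, be the ideal observations and $\tilde y\in\mathcal Y^m$ the actual observations. Let $\mathcal L\colon\mathbb{R}\times\mathcal Y\to\mathbb{R}$ be convex and continuously differentiable in the first variable, with $\mathcal L'=\partial\mathcal L/\partial v$ Lipschitz continuous in the second variable uniformly in the first. Let $\mu$ be the associated scaling parameter, and let $K\subset\mathbb{R}^n$ be a (not necessarily convex) set with $\mu x_0\in K$. Fix $t>0$ and assume in addition: (L3) $\mathcal L$ is twice continuously differentiable in the first variable; write $\mathcal L''=\partial^2\mathcal L/\partial v^2$. (L4) There are fixed numbers $0<M,N\le\infty$ with $M\ge\max\{32t,\,C_1|\mu|\}$ and $N\ge C_2\,\mathbb{E}[|f(g)|]+\|y-\tilde y\|_\infty$, where $g\sim\mathcal N(0,1)$, and a constant $C_{M,N}>0$ such that $$\mathcal L''(v,y)\ge C_{M,N}\quad\text{for all }(v,y)\in(-M,M)\times\big((-N,N)\cap\mathcal Y\big).$$ Then the following holds with probability at least $1-\exp(-C_4\cdot m)$: if $$m\ge C_3\cdot d_t(K-\mu x_0),$$ then the empirical loss $\bar{\mathcal L}_{\tilde y}(x)=\frac1m\sum_{i=1}^m\mathcal L(\langle a_i,x\rangle,\tilde y_i)$ satisfies restricted strong convexity at scale $t$ with respect to $\mu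 x_0$ and $K$, i.e. there exists $C_{\mathrm{RSC}}>0$, depending only on $C_{M,N}$, such that $$\bar{\mathcal L}_{\tilde y}(x)-\bar{\mathcal L}_{\tilde y}(\mu x_0)-\langle\nabla\bar{\mathcal L}_{\tilde y}(\mu x_0),x-\mu x_0\rangle\ge C_{\mathrm{RSC}}\|x-\mu x_0\|_2^2\quad\text{for all }x\in K\cap(tS^{n-1}+\mu x_0).$$
   Context: A numerical constant is one whose value is independent of all other parameters of the setup. Observation model: $\mathcal Y\subset\mathbb{R}$ is closed and $f\colon\mathbb{R}\to\mathcal Y$ is a (possibly random) function independent of the $a_i$; the randomness of $f$ is understood measurement-wise, i.e. for each $i$ an independent copy of $f$ is used in $y_i=f(\langle a_i,x_0\rangle)$. The vector $\tilde y=(\tilde y_1,\dots,\tilde y_m)\in\mathcal Y^m$ is arbitrary; its deviation from $y$ may be deterministic or random and may depend on the $a_i$. Lipschitz assumption: there is $C_{\mathcal L'}>0$ with $|\mathcal L'(v,y)-\mathcal L'(v,\tilde y)|\le C_{\mathcal L'}|y-\tilde y|$ for all $v\in\mathbb{R}$, $y,\tilde y\in\mathcal Y$. Scaling parameter: $\mu\in\mathbb{R}$ is the solution of $0=\mathbb{E}[\mathcal L'(\mu g,f(g))\cdot g]$, $g\sim\mathcal N(0,1)$ independent of $f$ (solvability is postulated). Local effective dimension: for $L\subset\mathbb{R}^n$ and $t>0$, $w_t(L):=\mathbb{E}[\sup_{x\in L\cap tB_2^n}\langle g,x\rangle]$ with $g\sim\mathcal N(0,I_n)$ and $B_2^n$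 the Euclidean unit ball, and $d_t(L):=w_t(L)^2/t^2$. If $\|y-\tilde y\|_\infty$ is random, the inequality for the fixed number $N$ in (L4) is meant to hold (almost) surely.
   Formalization: In the degenerate case E|f(g)| = 0 the formal theorem additionally requires the strict inequality ‖y−ỹ‖_∞ < N almost surely; as printed, (L4) allows N = ‖y−ỹ‖_∞ there, and the claim is then false. *)

(* Defs.v *)
From mathcomp Require Export all_boot all_order all_algebra.
From mathcomp Require Export all_classical all_reals all_analysis.

Set Implicit Arguments.
Unset Strict Implicit.
Unset Printing Implicit Defensive.

Export Order.TTheory GRing.Theory Num.Theory.
Export numFieldNormedType.Exports.

Local Open Scope classical_set_scope.
Local Open Scope ring_scope.

Definition gauss1 {R : realType} : probability (measurableTypeR R) R :=
  normal_prob 0 1.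

Section Euclidean.
Context {R : realType} {n : nat}.
Implicit Types (u v x : 'rV[R]_n) (F : 'rV[R]_n -> R).

Definition dot u v : R := \sum_(j < n) u 0 j * v 0 j.

(* The library norm `|u| on 'rV_n is the sup-norm, hence this one. *)
Definition norm2 u : R := Num.sqrt (dot u u).

Definition gradient F x : 'rV[R]_n := \row_j 'D_(delta_mx 0 j) F x.

Definition restricted_strong_convexity F (K : set 'rV[R]_n) (z : 'rV[R]_n)
    (t C : R) : Prop :=
  forall x, K x -> norm2 (x - z) = t ->
    C * norm2 (x - z) ^+ 2 <= F x - F z - dot (gradient F z) (x - z).

End Euclidean.

Section Probability.
Context {R : realType} {d : measure_display} {T : measurableType d}.
Variable P : probability T R.

Definition has_law {d'} {S : measurableType d'} (X : T -> S)
    (Q : probability S R) : Prop :=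
  measurable_fun setT X /\ forall A, measurable A -> P (X @^-1` A) = Q A.

Definition mutually_independent {I : finType} (F : I -> set_system T) : Prop :=
  forall (J : {set I}) (A : I -> set T), (forall i, i \in J -> F i (A i)) ->
    P (\bigcap_(i in [set` J]) A i) = (\prod_(i in J) P (A i))%E.

Definition sigma_of {d'} {S : measurableType d'} (X : T -> S) : set_system T :=
  preimage_set_system setT X measurable.

Definition sigma_of_vector {n} (X : T -> 'rV[R]_n) : set_system T :=
  g_sigma_preimage (fun (j : 'I_n) w => X w 0 j).

(* The law N(0, I_n): independent N(0,1) coordinates. *)
Definition standard_gaussian {n} (g : T -> 'rV[R]_n) : Prop :=
  (forall j, has_law (fun w => g w 0 j : measurableTypeR R) gauss1) /\
  mutually_independent (fun j : 'I_n => sigma_of (fun w => g w 0 j : R)).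

(* In the next two definitions g is meant to be a standard Gaussian vector;
   the values depend only on its law. *)
Definition local_mean_width {n} (g : T -> 'rV[R]_n) (t : R)
    (L : set 'rV[R]_n) : \bar R :=
  (\int[P]_w ereal_sup
     [set (dot (g w) x)%:E | x in L `&` [set x | norm2 x <= t]%R])%E.

Definition local_effective_dimension {n} (g : T -> 'rV[R]_n) (t : R)
    (L : set 'rV[R]_n) : \bar R :=
  (local_mean_width g t L * local_mean_width g t L * ((t ^+ 2)^-1)%:E)%E.

End Probability.

(* A random function is a jointly measurable f : S -> R -> R, the first argument
   being a seed drawn from a probability Q on S (S = unit if f is
   deterministic). For g ~ N(0,1) independent of f, the pair (seed, g) has law
   Q \x N(0,1). *)
Section Observations.
Context {R : realType} {d : measure_display} {S : measurableType d}.
Variables (Q : probability S R) (f : S -> R -> R).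

Definition expected_abs_output : \bar R :=
  (\int[Q \x gauss1]_z (`|f z.1 z.2|)%:E)%E.

(* L' and L'' *)
Definition dloss (L : R -> R -> R) (v y : R) : R := derive1 (L ^~ y) v.
Definition d2loss (L : R -> R -> R) (v y : R) : R := derive1n 2 (L ^~ y) v.

Definition scaling_parameter (L : R -> R -> R) (mu : R) : Prop :=
  let h z := (dloss L (mu * z.2) (f z.1 z.2) * z.2)%:E in
  let gamma := (Q \x gauss1)%E in
  gamma.-integrable setT h /\ (\int[gamma]_z h z = 0)%E.

(* Ideal observations, one independent seed per measurement. *)
Definition observations {d'} {T : measurableType d'} {m n : nat}
    (xi : 'I_m -> T -> S) (a : 'I_m -> T -> 'rV[R]_n) (x0 : 'rV[R]_n)
    (w : T) : 'rV[R]_m :=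
  \row_i f (xi i w) (dot (a i w) x0).

End Observations.

(* a_1, ..., a_m ~ N(0, I_n) and the seeds xi_1, ..., xi_m ~ Q are all
   independent. *)
Definition measurement_ensemble {R : realType} {d d' : measure_display}
    {T : measurableType d} {S : measurableType d'} (P : probability T R)
    (Q : probability S R) {m n : nat} (a : 'I_m -> T -> 'rV[R]_n)
    (xi : 'I_m -> T -> S) : Prop :=
  [/\ forall i, standard_gaussian P (a i),
      forall i, has_law P (xi i) Q &
      mutually_independent P (fun k : 'I_m + 'I_m =>
        match k with
        | inl i => sigma_of_vector (a i)
        | inr i => sigma_of (xi i)
        end)].

Definition empirical_loss {R : realType} {m n : nat} (L : R -> R -> R)
    (a : 'I_m -> 'rV[R]_n) (y : 'rV[R]_m) (x : 'rV[R]_n) : R :=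
  m%:R^-1 * \sum_(i < m) L (dot (a i) x) (y 0 i).

(* A loss on R * Y is given by a function L on R * R of which only the values
   at y in Y matter. *)
Section Loss.
Context {R : realType}.
Variables (Y : set R) (L : R -> R -> R).

Definition convex_loss : Prop :=
  forall y, Y y -> convex_function (E := R^o) setT (L ^~ y).

Definition C1_loss : Prop :=
  forall y, Y y -> (forall v, derivable (L ^~ y) v 1) /\
                   continuous (fun v => dloss L v y).

Definition C2_loss : Prop :=
  forall y, Y y -> [/\ forall v, derivable (L ^~ y) v 1,
                       forall v, derivable (fun v => dloss L v y) v 1 &
                       continuous (fun v => d2loss L v y)].

Definition lipschitz_dloss (CL : R) : Prop :=
  forall v y y', Y y -> Y y' ->
    `|dloss L v y - dloss L v y'| <= CL * `|y - y'|.

Definition d2loss_lower_bound (M N : \bar R) (C : R) : Prop :=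
  forall v y : R, (- M < v%:E < M)%E -> (- N < y%:E < N)%E -> Y y ->
    C <= d2loss L v y.

End Loss.

(* Main.v *)
(** Fix a unit vector [h = (x - mu x0) / t]. Every summand of the Bregman
    difference of the empirical loss is nonnegative by convexity, and it is at
    least [CMN t^2 / 2] times [tent <a_i, h>] when the measurement is good, that
    is, when [<a_i, x0>] is bounded and [y_i] is not much larger than its mean.
    Hence it suffices to bound the sum [Z h] of [tent <a_i, h>] over the good
    measurements from below, uniformly in [h]. The supremum over finitely many
    [h] of [E Z h - Z h] concentrates by McDiarmid's argument (one measurement
    changes it by at most 1). Its expectation is bounded by replacing, one
    measurement at a time, the centred tent function by the Gaussian
    [2 <a_i, h>]: a ghost copy and a two-point contraction inequality suffice,
    because [<a_i, h>] is symmetric. Since the sum of the [a_i] has the law of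
    [sqrt m g], the bound is [2 sqrt m w_t / t]. A countable dense set of
    directions and continuity of the measure give the uniform statement. *)
Require Import Defs.
From mathcomp Require Import measurable_realfun ring lra.

Local Open Scope classical_set_scope.
Local Open Scope ring_scope.

(** * One-dimensional Gaussian integrals *)

(** Replacing one measurement at a time stands in for Rademacher symmetrization. Every average is an
    operator [G -> E G(u + X)] on nonnegative measurable functions of the shift [u]; sums of
    independent vectors become compositions, and the operators commute by Tonelli. No enlarged
    probability space with signs or with a second full sample has to be built. The baseline 0 in the
    maximum costs nothing against the mean width, because 0 lies in [K - mu x0]. A tent rather than
    an indicator is counted because contraction needs a Lipschitz function. All constants come from
    its Gaussian mean [p0]: bad measurements have probability at most [p0 / 2], so the mean count is
    at least [m p0 / 2], and a deviation of [m p0 / 4] still leaves [m p0 / 4]. *)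

Definition image_measure {d1 d2} {T1 : measurableType d1} {T2 : measurableType d2}
    {R : realType} (m : measure T1 R) {f : T1 -> T2}
    (mf : measurable_fun setT f) : measure T2 R.
Proof. exact: (pushforward m f : measure T2 R). Defined.

Lemma ge0_integral_image {d1 d2} {T1 : measurableType d1}
    {T2 : measurableType d2} {R : realType} (m : measure T1 R) (f : T1 -> T2)
    (mf : measurable_fun setT f) (G : T2 -> \bar R) :
  measurable_fun setT G -> (forall x, 0 <= G x)%E ->
  (\int[image_measure m mf]_y G y = \int[m]_x G (f x))%E.
Proof. by move=> mG G0; rewrite ge0_integral_pushforward. Qed.

Section tonelli.
Context {d1 d2} {T1 : measurableType d1} {T2 : measurableType d2} {R : realType}.
Variables (m1 : {sigma_finite_measure set T1 -> \bar R})
  (m2 : {sigma_finite_measure set T2 -> \bar R}) (f : T1 -> T2 -> \bar R).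
Hypotheses (mf : measurable_fun setT (fun z : T1 * T2 => f z.1 z.2))
  (f0 : forall x y, (0 <= f x y)%E).

Lemma measurable_integral_tonelli :
  measurable_fun setT (fun x => \int[m2]_y f x y)%E.
Proof.
exact: (@measurable_fun_fubini_tonelli_F _ _ _ _ _ m2 (fun z => f z.1 z.2)).
Qed.

Lemma tonelli_swap :
  (\int[m1]_x \int[m2]_y f x y = \int[m2]_y \int[m1]_x f x y)%E.
Proof. exact: (@fubini_tonelli _ _ _ _ _ m1 m2 (fun z => f z.1 z.2)). Qed.

End tonelli.

Lemma integral_cst_probability {d} {T : measurableType d} {R : realType}
    (P : probability T R) (c : \bar R) : (\int[P]_x c = c)%E.
Proof.
rewrite (integral_cst P measurableT) -[RHS]mule1; congr *%E.
exact: probability_setT.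
Qed.

Section density.
Context {d} {T : measurableType d} {R : realType}.
Variables (mu nu : {measure set T -> \bar R}) (p : T -> R).
Hypotheses (mp : measurable_fun setT p) (p0 : forall x, 0 <= p x).
Hypothesis nuE : forall A, measurable A -> nu A = (\int[mu]_(x in A) (p x)%:E)%E.

Import HBNNSimple.

Let integral_density_nnsfun (f : {nnsfun T >-> R}) :
  (\int[nu]_x (f x)%:E = \int[mu]_x ((f x)%:E * (p x)%:E))%E.
Proof.
under [LHS]eq_integral do rewrite fimfunE -fsumEFin//.
rewrite [LHS]ge0_integral_fsum//; last 2 first.
  - by move=> r; exact/measurable_EFinP/measurableT_comp.
  - by move=> n x _; rewrite EFinM nnfun_muleindic_ge0.
under [RHS]eq_integral.
  move=> x xD; rewrite fimfunE -fsumEFin// ge0_mule_fsuml; last first.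
    by move=> r; rewrite EFinM nnfun_muleindic_ge0.
  over.
rewrite [RHS]ge0_integral_fsum//; last 2 first.
  - by move=> r; apply: emeasurable_funM; apply/measurable_EFinP => //;
      apply: measurable_funM => //.
  - move=> n x _; rewrite mule_ge0//; last by rewrite lee_fin.
    by rewrite EFinM nnfun_muleindic_ge0.
apply: eq_fsbigr => r _.
rewrite integralZl_indic_nnsfun// integral_indic// setIT nuE//.
(* A nonnegative simple function has no negative value: the preimage is empty and both sides
   vanish. *)
have [r0|r0] := ltP r 0.
  rewrite preimage_nnfun0//= integral_set0 mule0.
  by under eq_integral do rewrite indic0 mulr0 mul0e; rewrite integral0.
rewrite integral_mkcond -ge0_integralZl//=.
- apply: eq_integral => x _; rewrite patchE indicE.
  by case: ifPn => _; rewrite ?mulr1 // mulr0 mule0 mul0e.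
- apply/(measurable_restrictT _ _).1 => //.
  by apply: measurable_funTS; exact/measurable_EFinP.
- by move=> x _; rewrite patchE; case: ifPn; rewrite lee_fin.
Qed.

(** Simple functions first, then monotone convergence. The Gaussian law is known through its density
    on sets; this makes substitution in Gaussian integrals possible. *)
Lemma ge0_integral_density (f : T -> \bar R) :
  measurable_fun setT f -> (forall x, 0 <= f x)%E ->
  (\int[nu]_x f x = \int[mu]_x (f x * (p x)%:E))%E.
Proof.
move=> mf f0.
pose f_ := nnsfun_approx measurableT mf.
transitivity (lim (\int[nu]_x (f_ n x)%:E @[n --> \oo])%E).
  rewrite -monotone_convergence//=.
  - apply: eq_integral => ? /[!inE] xD; apply/esym/cvg_lim => //=.
    exact: cvg_nnsfun_approx.
  - by move=> n; exact/measurable_EFinP/measurable_funTS.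
  - by move=> n ? _; rewrite lee_fin.
  - by move=> ? _ ? ? mn; rewrite lee_fin; exact/lefP/nd_nnsfun_approx.
transitivity (lim (\int[mu]_x ((f_ n x)%:E * (p x)%:E) @[n --> \oo])%E).
  by apply: congr_lim; apply/funext => n /=; exact: integral_density_nnsfun.
rewrite -monotone_convergence//=.
- apply: eq_integral => x _; apply: cvg_lim => //.
  apply: cvgeZr => //; exact: cvg_nnsfun_approx.
- move=> n; apply: emeasurable_funM; apply/measurable_EFinP => //.
- by move=> n ? _; rewrite mule_ge0// lee_fin.
- move=> x _ m n mn; rewrite lee_pmul ?lee_fin//; exact/lefP/nd_nnsfun_approx.
Qed.

End density.

Section lebesgue_affine.
Context {R : realType}.
Local Notation mu := (@lebesgue_measure R).

(** By uniqueness of Lebesgue measure: its image under [x -> s x + c], rescaled by [s], gives every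
    half-open interval its length. *)
Lemma ge0_integral_affine (f : R -> \bar R) (s c : R) : 0 < s ->
  measurable_fun setT f -> (forall x, 0 <= f x)%E ->
  (\int[mu]_x f x = s%:E * \int[mu]_x f (s * x + c)%R)%E.
Proof.
move=> s0 mf f0.
have mphi : measurable_fun setT (fun x : measurableTypeR R => s * x + c : measurableTypeR R).
  by apply: measurable_funD => //; apply: measurable_funM.
pose s' : {nonneg R} := NngNum (ltW s0).
pose nu : measure _ R := mscale s' (image_measure mu mphi).
have H A : measurable A -> mu A = nu A.
  move=> mA; apply: (@lebesgue_measure_unique R nu) => //= _ [[a b]] /= _ <-.
  rewrite /nu /mscale/= /pushforward/=.
  have -> : (fun x : R => s * x + c) @^-1` `]a, b] = `](a - c) / s, (b - c) / s]%classic.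
    by apply/seteqP; split=> x /=; rewrite !in_itv /= ltr_pdivrMr// ler_pdivlMr//
      mulrC ltrBlDr lerBrDr.
  rewrite !lebesgue_measure_itv/= !lte_fin ltr_pM2r ?invr_gt0// ltrD2r.
  case: ifPn => ab; rewrite ?mule0//.
  by rewrite -!EFinD -EFinM; congr (_%:E); field; rewrite gt_eqF.
rewrite (@eq_measure_integral _ _ _ setT nu); last by move=> A mA _; exact: H.
by rewrite /nu ge0_integral_mscale//= ge0_integral_image.
Qed.

End lebesgue_affine.

Section gauss.
Context {R : realType}.
Local Notation mu := (@lebesgue_measure R).
Local Notation p := (@normal_pdf R 0 1).

Lemma ge0_integral_gauss1 (f : R -> \bar R) :
  measurable_fun setT f -> (forall x, 0 <= f x)%E ->
  (\int[gauss1]_x f x = \int[mu]_x (f x * (p x)%:E))%E.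
Proof.
move=> mf f0; apply: ge0_integral_density => //.
- exact: measurable_normal_pdf.
- exact: normal_pdf_ge0.
Qed.

Lemma gauss1_pdfE (x : R) : p x = normal_peak 1 * expR (- (x ^+ 2 / 2)).
Proof.
rewrite normal_pdfE ?oner_neq0// /normal_fun subr0 expr1n mulNr.
by rewrite mulr2n.
Qed.

Lemma ge0_integral_gauss1N (f : R -> \bar R) :
  measurable_fun setT f -> (forall x, 0 <= f x)%E ->
  (\int[gauss1]_x f (- x)%R = \int[gauss1]_x f x)%E.
Proof.
move=> mf f0.
have mN : measurable_fun setT (fun x : measurableTypeR R => - x : measurableTypeR R).
  exact: measurable_funN.
have mp : measurable_fun setT p by exact: measurable_normal_pdf.
rewrite !ge0_integral_gauss1//; last exact: measurableT_comp.
rewrite [RHS](@eq_measure_integral _ _ _ setT (image_measure mu mN)); last first.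
  by move=> A mA _; rewrite /= lebesgue_measureN.
rewrite ge0_integral_image; last 2 first.
- by apply: emeasurable_funM => //; exact/measurable_EFinP.
- by move=> x; rewrite mule_ge0// lee_fin normal_pdf_ge0.
by apply: eq_integral => x _; rewrite !gauss1_pdfE sqrrN.
Qed.

Lemma integral_lebesgue_pdf_affine (s c : R) : 0 < s ->
  (\int[mu]_x (p (s * x + c))%:E = s^-1%:E)%E.
Proof.
move=> s0; have := @integral_normal_pdf R 0 1.
rewrite (@ge0_integral_affine _ _ s c)//; last 2 first.
- by apply/measurable_EFinP; exact: measurable_normal_pdf.
- by move=> x; rewrite lee_fin normal_pdf_ge0.
move=> /(congr1 (fun x => s^-1%:E * x)%E).
by rewrite muleA -EFinM mulVf ?gt_eqF// mul1e mule1.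
Qed.

(** Independent centred normals add their variances. Substitute [u = a x + b y] in the inner
    integral, exchange the integrals and complete the square in [x]; what is left of the
    [x]-integral is a rescaled Gaussian density of mass [b / r]. *)
Lemma gauss1_conv_gt0 (f : R -> \bar R) (a b : R) : 0 < a -> 0 < b ->
  measurable_fun setT f -> (forall x, 0 <= f x)%E ->
  (\int[gauss1]_x \int[gauss1]_y f (a * x + b * y)%R =
   \int[gauss1]_z f (Num.sqrt (a ^+ 2 + b ^+ 2) * z)%R)%E.
Proof.
move=> a0 b0 mf f0; set r := Num.sqrt _.
have r20 : 0 < a ^+ 2 + b ^+ 2 by rewrite addr_gt0// exprn_gt0.
have r0 : 0 < r by rewrite sqrtr_gt0.
have rE : r ^+ 2 = a ^+ 2 + b ^+ 2 by rewrite sqr_sqrtr// ltW.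
have mp : measurable_fun setT p by exact: measurable_normal_pdf.
have p0 x : 0 <= p x by exact: normal_pdf_ge0.
have mlin (c e : R) : measurable_fun setT (fun x : R => c * x + e).
  by apply: measurable_funD => //; apply: measurable_funM.
have mmul (c : R) : measurable_fun setT (fun x : R => c * x).
  exact: measurable_funM.
have mq x : measurable_fun setT (fun u : R => p (b^-1 * (u - a * x))).
  by apply: measurableT_comp => //; apply: measurable_funM => //; exact: measurable_funB.
have inner x : (\int[gauss1]_y f (a * x + b * y)%R =
    \int[mu]_u (f u * (b^-1 * p (b^-1 * (u - a * x)))%:E))%E.
  have mfx : measurable_fun setT (fun y : R => f (a * x + b * y)).
    have ml : measurable_fun setT (fun y : R => a * x + b * y).
      by apply: measurable_funD => //; exact: measurable_funM.
    exact: (measurableT_comp mf ml).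
  rewrite ge0_integral_gauss1//.
  rewrite (@ge0_integral_affine _ (fun y => (f (a * x + b * y)%R * (p y)%:E)%E)
    b^-1 (- (b^-1 * (a * x)))); last 3 first.
  - by rewrite invr_gt0.
  - by apply: emeasurable_funM => //; exact/measurable_EFinP.
  - by move=> y; rewrite mule_ge0// lee_fin.
  rewrite -ge0_integralZl; last 4 first.
  - by [].
  - have : measurable_fun setT (fun u : R =>
        f (a * x + b * (b^-1 * u + - (b^-1 * (a * x))))%R *
        (p (b^-1 * u + - (b^-1 * (a * x))))%:E)%E.
      apply: emeasurable_funM.
        apply: (measurableT_comp mfx (mlin _ _)).
      by apply/measurable_EFinP; exact: (measurableT_comp mp (mlin _ _)).
    by apply.
  - by move=> y _; rewrite mule_ge0// lee_fin.
  - by rewrite lee_fin invr_ge0 ltW.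
  apply: eq_integral => u _.
  rewrite EFinM muleCA; congr (f _ * (_ * _%:E))%E.
    by field; rewrite gt_eqF.
  by congr (p _); rewrite mulrBr.
under eq_integral do rewrite inner.
have mK' : measurable_fun setT
    (fun z : R * R => (f z.2 * (b^-1 * p (b^-1 * (z.2 - a * z.1)))%:E)%E).
  apply: emeasurable_funM; first exact: measurableT_comp.
  apply/measurable_EFinP; apply: measurable_funM => //.
  apply: measurableT_comp => //; apply: measurable_funM => //.
  apply: measurable_funB => //; exact: measurable_funM.
have mK : measurable_fun setT (fun z : R * R =>
    (f z.2 * (b^-1 * p (b^-1 * (z.2 - a * z.1)))%:E * (p z.1)%:E)%E).
  apply: emeasurable_funM; last first.
    by apply/measurable_EFinP; exact: measurableT_comp.
  exact: mK'.
have K0 z : (0 <= f z.2 * (b^-1 * p (b^-1 * (z.2 - a * z.1)))%:E * (p z.1)%:E)%E.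
  by rewrite !mule_ge0// lee_fin// mulr_ge0// invr_ge0 ltW.
have mI x : measurable_fun setT (fun u : R => f u * (b^-1 * p (b^-1 * (u - a * x)))%:E)%E.
  by apply: emeasurable_funM => //; apply/measurable_EFinP; exact: measurable_funM.
have I0 x u : (0 <= f u * (b^-1 * p (b^-1 * (u - a * x)))%:E)%E.
  by rewrite mule_ge0// lee_fin mulr_ge0// invr_ge0 ltW.
(* Completing the square: the exponents of the two sides differ by a multiple of
   [r ^+ 2 - (a ^+ 2 + b ^+ 2)], which is zero. *)
have key (x u : R) : p (b^-1 * (u - a * x)) * p x =
    p (r^-1 * u) * p (r / b * x + - (a * u / (b * r))).
  rewrite !gauss1_pdfE mulrACA [RHS]mulrACA -!expRD; congr (_ * expR _).
  rewrite -!opprD -!mulrDl; congr (- (_ / 2)); apply/eqP; rewrite -subr_eq0.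
  have -> : (b^-1 * (u - a * x)) ^+ 2 + x ^+ 2 -
      ((r^-1 * u) ^+ 2 + (r / b * x + - (a * u / (b * r))) ^+ 2) =
      (r ^+ 2 - (a ^+ 2 + b ^+ 2)) * ((u ^+ 2 - r ^+ 2 * x ^+ 2) / (b ^+ 2 * r ^+ 2)).
    by field; rewrite !gt_eqF.
  by rewrite rE subrr mul0r.
transitivity (\int[mu]_x \int[mu]_u (f u * (b^-1 * p (b^-1 * (u - a * x)))%:E * (p x)%:E))%E.
  rewrite ge0_integral_gauss1; last 2 first.
  - exact: (measurable_integral_tonelli mu
      (fun x u : R => f u * (b^-1 * p (b^-1 * (u - a * x)))%:E)%E mK' I0).
  - by move=> x; apply: integral_ge0 => u _.
  apply: eq_integral => x _; rewrite -ge0_integralZr//; first exact: mI.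
  by rewrite lee_fin.
etransitivity; first exact: (tonelli_swap mu mu (fun x u : R =>
  f u * (b^-1 * p (b^-1 * (u - a * x)))%:E * (p x)%:E)%E mK (fun x u => K0 (x, u))).
cbv beta.
rewrite ge0_integral_gauss1; last 2 first.
- exact: (measurableT_comp mf (mmul r)).
- by [].
rewrite (@ge0_integral_affine _ (fun z => (f (r * z)%R * (p z)%:E)%E) r^-1 0); last 3 first.
- by rewrite invr_gt0.
- apply: emeasurable_funM; first exact: (measurableT_comp mf (mmul r)).
  exact/measurable_EFinP.
- by move=> z; rewrite mule_ge0// lee_fin.
rewrite -ge0_integralZl; last 4 first.
- by [].
- have : measurable_fun setT (fun u : R => f (r * (r^-1 * u + 0))%R * (p (r^-1 * u + 0))%:E)%E.
    apply: emeasurable_funM.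
      apply: (measurableT_comp mf); exact: (measurableT_comp (mmul r) (mlin _ _)).
    by apply/measurable_EFinP; exact: (measurableT_comp mp (mlin _ _)).
  by apply.
- by move=> z _; rewrite mule_ge0// lee_fin.
- by rewrite lee_fin invr_ge0 ltW.
apply: eq_integral => u _.
under eq_integral => x _ do rewrite -muleA -EFinM -mulrA key.
rewrite addr0 mulVKf ?gt_eqF// muleCA ge0_integralZl//; last 2 first.
- apply/measurable_EFinP; apply: measurable_funM => //; apply: measurable_funM => //.
  exact: (measurableT_comp mp (mlin _ _)).
- by move=> x _; rewrite lee_fin !mulr_ge0// invr_ge0 ltW.
congr (_ * _)%E.
under eq_integral => x _ do rewrite mulrA EFinM.
rewrite ge0_integralZl//; last 3 first.
- apply/measurable_EFinP; exact: (measurableT_comp mp (mlin _ _)).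
- by move=> x _; rewrite lee_fin.
- by rewrite lee_fin mulr_ge0// invr_ge0 ltW.
rewrite integral_lebesgue_pdf_affine ?divr_gt0// -!EFinM; congr _%:E.
by field; rewrite !gt_eqF.
Qed.

Lemma gauss1_scale_abs (f : R -> \bar R) (a : R) :
  measurable_fun setT f -> (forall x, 0 <= f x)%E ->
  (\int[gauss1]_x f (a * x)%R = \int[gauss1]_x f (`|a| * x)%R)%E.
Proof.
move=> mf f0; case: (lerP 0 a) => [a0|a0].
  by under eq_integral do rewrite -{1}(ger0_norm a0).
have ma : measurable_fun setT (fun x : R => f (a * x)) .
  by apply: (measurableT_comp mf); exact: measurable_funM.
rewrite -ge0_integral_gauss1N//.
by apply: eq_integral => x _; rewrite ltr0_norm// mulrN mulNr.
Qed.

(** Symmetry of the Gaussian reduces to nonnegative coefficients, and a vanishing coefficient leaves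
    a single integral. *)
Lemma gauss1_conv (f : R -> \bar R) (a b : R) :
  measurable_fun setT f -> (forall x, 0 <= f x)%E ->
  (\int[gauss1]_x \int[gauss1]_y f (a * x + b * y)%R =
   \int[gauss1]_z f (Num.sqrt (a ^+ 2 + b ^+ 2) * z)%R)%E.
Proof.
move=> mf f0.
have ms (c : R) : measurable_fun setT (fun x : R => f (c + x)).
  by apply: (measurableT_comp mf); exact: measurable_funD.
have -> : (\int[gauss1]_x \int[gauss1]_y f (a * x + b * y)%R =
    \int[gauss1]_x \int[gauss1]_y f (`|a| * x + `|b| * y)%R)%E.
  under eq_integral => x _ do rewrite (gauss1_scale_abs (fun u => f (a * x + u)%R))//.
  have mF : measurable_fun setT (fun z : R * R => f (z.1 + `|b| * z.2)).
    by apply: (measurableT_comp mf); apply: measurable_funD => //; exact: measurable_funM.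
  rewrite (gauss1_scale_abs (fun u => \int[gauss1]_y f (u + `|b| * y)%R)%E)//.
    exact: (measurable_integral_tonelli gauss1
      (fun x y : R => f (x + `|b| * y)%R) mF (fun x y => f0 _)).
  by move=> u; apply: integral_ge0.
rewrite -(real_normK (num_real a)) -(real_normK (num_real b)).
have := normr_ge0 a; rewrite le_eqVlt => /predU1P[<-|a0].
  under eq_integral do under eq_integral do rewrite mul0r add0r.
  by rewrite integral_cst_probability expr0n/= add0r sqrtr_sqr normr_id.
have := normr_ge0 b; rewrite le_eqVlt => /predU1P[<-|b0].
  under eq_integral do under eq_integral do rewrite mul0r addr0.
  under eq_integral do rewrite integral_cst_probability.
  by rewrite expr0n/= addr0 sqrtr_sqr normr_id.
exact: gauss1_conv_gt0.
Qed.

End gauss.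

(** * Independence *)

Section independent_groups.
Context {R : realType} {d : measure_display} {T : measurableType d}.
Variables (P : probability T R).

(** Preparation for the pi-lambda theorem with one event held fixed: complements work because [P] is
    finite, disjoint unions by countable additivity. *)
Lemma independent_of_dynkin (B : set T) : measurable B ->
  dynkin [set A | measurable A /\ P (A `&` B) = (P A * P B)%E].
Proof.
move=> mB; split => /=.
- by split; rewrite ?setTI ?probability_setT ?mul1e.
- move=> A [mA AB]; split; first exact: measurableC.
  have fA : P A \is a fin_num by exact: fin_num_measure.
  have fB : P B \is a fin_num by exact: fin_num_measure.
  have -> : P (~` A) = (1 - P A)%E by exact: probability_setC.
  have -> : ~` A `&` B = B `\` A by rewrite setIC setDE.
  transitivity (P B - P (B `&` A))%E.
    by apply: measureD => //; rewrite ltey_eq fB.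
  have -> : P (B `&` A) = (P A * P B)%E by rewrite setIC.
  by rewrite muleBl ?mul1e// fin_num_adde_defr.
- move=> A tA mA; split; first by apply: bigcup_measurable => k _; exact: (mA k).1.
  rewrite setI_bigcupl measure_bigcup//=; last 2 first.
  - by move=> k _; apply: measurableI => //; exact: (mA k).1.
  - exact: trivIset_setIr.
  rewrite measure_bigcup//=; last by move=> k _; exact: (mA k).1.
  have fB : P B \is a fin_num by exact: fin_num_measure.
  rewrite muleC -(fineK fB) -nneseriesZl//.
  apply: eq_eseriesr => k _; rewrite fineK// muleC; exact: (mA k).2.
Qed.

Context {I : finType}.
Variable F : I -> set_system T.
Hypotheses (indF : mutually_independent P F)
  (mF : forall i A, F i A -> measurable A)
  (FI : forall i, setI_closed (F i)) (FT : forall i, F i setT).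

(** The pi-system for the Dynkin argument. The generators below need not be stable under
    intersection, but are the convenient family for checking the measurability of a single
    variable. *)
Definition group_cylinders (J : {set I}) : set_system T :=
  [set B | exists2 A : I -> set T, (forall i, i \in J -> F i (A i)) &
    B = \bigcap_(i in [set` J]) A i].

Definition group_generators (J : {set I}) : set_system T :=
  [set B | exists2 i, i \in J & F i B].

Lemma group_cylinders_setI J : setI_closed (group_cylinders J).
Proof.
move=> _ _ [A FA ->] [B FB ->]; exists (fun i => A i `&` B i).
  by move=> i iJ; apply: FI; [exact: FA | exact: FB].
by rewrite bigcapI.
Qed.

Lemma group_cylinders_measurable J A : group_cylinders J A -> measurable A.
Proof.
move=> [B FB ->]; apply: fin_bigcap_measurable; first exact: finite_finset.
by move=> i iJ; exact: (mF _ _ (FB _ iJ)).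
Qed.

Lemma group_generators_cylinders J :
  <<s group_generators J >> `<=` <<s group_cylinders J >>.
Proof.
apply: smallest_sub; first exact: smallest_sigma_algebra.
move=> A [i iJ FA]; apply: sub_sigma_algebra.
exists (fun j => if j == i then A else setT).
  by move=> j _; case: eqP => [->//|_]; exact: FT.
apply/seteqP; split => [x Ax j _ /=|x /(_ i iJ)]; last by rewrite eqxx.
by case: ifP.
Qed.

(** Mutual independence speaks of one event per index. Two pi-lambda extensions, one group after the
    other, reach everything generated by two disjoint groups; on cylinders the product over the
    union of the index sets splits. *)
Lemma independent_groups (J1 J2 : {set I}) (A B : set T) :
  (forall i, i \in J1 -> i \notin J2) -> <<s group_generators J1 >> A ->
  <<s group_generators J2 >> B -> P (A `&` B) = (P A * P B)%E.
Proof.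
move=> J12 /group_generators_cylinders sA /group_generators_cylinders sB.
have sm J : <<s group_cylinders J >> `<=` measurable.
  apply: smallest_sub; first exact: sigma_algebra_measurable.
  exact: group_cylinders_measurable.
have cyl C D : group_cylinders J1 C -> group_cylinders J2 D ->
    P (C `&` D) = (P C * P D)%E.
  move=> [E FE ->] [G FG ->].
  pose H i := if i \in J1 then E i else G i.
  have H1 : \bigcap_(i in [set` J1]) E i = \bigcap_(i in [set` J1]) H i.
    by apply: eq_bigcapr => i /= iJ; rewrite /H iJ.
  have H2 : \bigcap_(i in [set` J2]) G i = \bigcap_(i in [set` J2]) H i.
    apply: eq_bigcapr => i /= iJ; rewrite /H; case: ifP => // /J12.
    by rewrite iJ.
  have FH i : i \in J1 :|: J2 -> F i (H i).
    rewrite finset.in_setU /H; case: ifP => [iJ _|_ /= iJ]; first exact: FE.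
    exact: FG.
  have -> : \bigcap_(i in [set` J1]) E i `&` \bigcap_(i in [set` J2]) G i =
      \bigcap_(i in [set` J1 :|: J2]) H i.
    rewrite H1 H2 -bigcap_setU; congr bigcap.
    by apply/seteqP; split => i /=; rewrite finset.in_setU => /orP.
  rewrite H1 H2 !indF//.
  - rewrite (eq_bigl [in [predU J1 & J2]]); last first.
      by move=> i; rewrite finset.in_setU !inE.
    rewrite bigU//= fintype.disjoint_subset; apply/fintype.subsetP => i iJ.
    by rewrite inE J12.
  - by move=> i iJ; apply: FH; rewrite finset.in_setU iJ orbT.
  - by move=> i iJ; apply: FH; rewrite finset.in_setU iJ.
have step C : group_cylinders J2 C -> P (A `&` C) = (P A * P C)%E.
  move=> sC; have mC := group_cylinders_measurable _ _ sC.
  have : <<d group_cylinders J1 >> `<=` [set D | measurable D /\ P (D `&` C) = (P D * P C)%E].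
    apply: smallest_sub; first exact: independent_of_dynkin.
    by move=> D sD; split; [exact: group_cylinders_measurable sD | exact: cyl].
  rewrite setI_closed_g_dynkin_g_sigma_algebra; last exact: group_cylinders_setI.
  by move=> /(_ _ sA)[].
have mA := sm _ _ sA.
have : <<d group_cylinders J2 >> `<=` [set D | measurable D /\ P (D `&` A) = (P D * P A)%E].
  apply: smallest_sub; first exact: independent_of_dynkin.
  move=> D sD; split; first exact: group_cylinders_measurable sD.
  by rewrite setIC muleC; exact: step.
rewrite setI_closed_g_dynkin_g_sigma_algebra; last exact: group_cylinders_setI.
by move=> /(_ _ sB)[_]; rewrite setIC muleC.
Qed.

End independent_groups.

Section decoupling.
Context {R : realType} {d d1 d2 : measure_display} {T : measurableType d}
  {S1 : measurableType d1} {S2 : measurableType d2}.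
Variable P : probability T R.

Definition independent_pair (X : T -> S1) (Y : T -> S2) : Prop :=
  forall A B, measurable A -> measurable B ->
    P (X @^-1` A `&` Y @^-1` B) = (P (X @^-1` A) * P (Y @^-1` B))%E.

(** The law of the pair is the product of its marginals, so Tonelli applies; [w'] then plays the
    role of an independent copy. *)
Lemma integral_independent_pair (X : T -> S1) (Y : T -> S2)
    (G : S1 -> S2 -> \bar R) :
  measurable_fun setT X -> measurable_fun setT Y -> independent_pair X Y ->
  measurable_fun setT (fun z : S1 * S2 => G z.1 z.2) ->
  (forall x y, 0 <= G x y)%E ->
  (\int[P]_w G (X w) (Y w) = \int[P]_w \int[P]_w' G (X w) (Y w'))%E.
Proof.
move=> mX mY XY mG G0.
have mXY : measurable_fun setT (fun w => (X w, Y w)) by exact: measurable_fun_pair.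
pose X' : {mfun T >-> S1} := mfun_Sub (mem_set mX : X \in mfun).
pose Y' : {mfun T >-> S2} := mfun_Sub (mem_set mY : Y \in mfun).
have E := @product_measure_unique _ _ _ _ _ (distribution P X') (distribution P Y')
  (image_measure P mXY) XY.
transitivity (\int[image_measure P mXY]_z G z.1 z.2)%E.
  by rewrite ge0_integral_image.
rewrite -(@eq_measure_integral _ _ _ setT _ (distribution P X' \x distribution P Y')%E);
  last by move=> A mA _; rewrite -E.
rewrite fubini_tonelli1//= ge0_integral_distribution//=; last 2 first.
- exact: (measurable_integral_tonelli (distribution P Y') G).
- by move=> x; apply: integral_ge0.
apply: eq_integral => w _.
rewrite /fubini_F ge0_integral_distribution//=.
have m1 : measurable_fun setT (fun y : S2 => (X w, y)) by exact: measurable_fun_pair.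
exact: (measurableT_comp mG m1).
Qed.

End decoupling.

(** * Gaussian vectors as iterated one-dimensional averages *)

Lemma integral_has_law {R : realType} {d d'} {T : measurableType d}
    {S : measurableType d'} (P : probability T R) (Q : probability S R)
    (X : T -> S) (G : S -> \bar R) : has_law P X Q ->
  measurable_fun setT G -> (forall x, 0 <= G x)%E ->
  (\int[P]_w G (X w) = \int[Q]_x G x)%E.
Proof.
move=> [mX XQ] mG G0.
rewrite -(@eq_measure_integral _ _ _ setT _ (image_measure P mX)).
  by rewrite ge0_integral_image.
by move=> A mA _; exact: XQ.
Qed.

(** Measurability with respect to a group is phrased as measurability from [T] carrying the
    generated sigma-algebra, so that the usual closure lemmas apply to it. *)
Lemma measurable_group {R : realType} {d d'} {T : measurableType d}
    {S : measurableType d'} {I : finType} (F : I -> set_system T)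
    (J : {set I}) (i : I) (X : T -> S) : i \in J ->
  (forall A, measurable A -> F i (X @^-1` A)) ->
  measurable_fun (setT : set (g_sigma_algebraType (group_generators F J))) X.
Proof.
move=> iJ FX _ A mA; rewrite setTI; apply: sub_sigma_algebra.
by exists i => //; exact: FX.
Qed.

Lemma independent_pair_groups {R : realType} {d d1 d2} {T : measurableType d}
    {S1 : measurableType d1} {S2 : measurableType d2} {I : finType}
    (P : probability T R) (F : I -> set_system T) (J1 J2 : {set I})
    (X : T -> S1) (Y : T -> S2) :
  mutually_independent P F -> (forall i, sigma_algebra setT (F i)) ->
  (forall i A, F i A -> measurable A) ->
  (forall i, i \in J1 -> i \notin J2) ->
  measurable_fun (setT : set (g_sigma_algebraType (group_generators F J1))) X ->
  measurable_fun (setT : set (g_sigma_algebraType (group_generators F J2))) Y ->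
  independent_pair P X Y.
Proof.
move=> indF sF mF J12 mX mY A B mA mB.
apply: (independent_groups P F indF mF _ _ J1 J2) => //.
- by move=> i; have /(sigma_algebraP (fun _ _ => @subsetT _ _))[] := sF i.
- by move=> i; have /(sigma_algebraP (fun _ _ => @subsetT _ _))[] := sF i.
- by have := mX measurableT A mA; rewrite setTI.
- by have := mY measurableT B mB; rewrite setTI.
Qed.

Lemma sigma_of_sigma_algebra {d d'} {T : measurableType d}
    {S : measurableType d'} (X : T -> S) : sigma_algebra setT (sigma_of X).
Proof. exact: sigma_algebra_preimage (@sigma_algebra_measurable _ _). Qed.

Lemma sum_ord_ltS {V : nmodType} {n} (x : 'I_n -> V) (k : 'I_n) :
  \sum_(j < n | (j < k.+1)%N) x j = \sum_(j < n | (j < k)%N) x j + x k.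
Proof.
rewrite (bigD1 k)//= addrC; congr (_ + _); apply: eq_bigl => j.
by rewrite ltnS -(inj_eq val_inj)/= ltn_neqAle andbC.
Qed.

(** * Averages over random shifts of a vector *)

Section vectors.
Context {R : realType} {N : nat}.
Notation V := (N.-tuple R).
Implicit Types u v : V.

Definition vadd u v : V := [tuple tnth u i + tnth v i | i < N].
Definition vscale (c : R) v : V := [tuple c * tnth v i | i < N].
Definition vzero : V := [tuple 0 | i < N].

Lemma tnth_vadd u v i : tnth (vadd u v) i = tnth u i + tnth v i.
Proof. by rewrite tnth_mktuple. Qed.

Lemma tnth_vscale c v i : tnth (vscale c v) i = c * tnth v i.
Proof. by rewrite tnth_mktuple. Qed.

Lemma tnth_vzero i : tnth vzero i = 0.
Proof. by rewrite tnth_mktuple. Qed.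

Definition vE := (tnth_vadd, tnth_vscale, tnth_vzero).

Lemma vaddC u v : vadd u v = vadd v u.
Proof. by apply: eq_from_tnth => i; rewrite !vE addrC. Qed.

Lemma vaddA u v w : vadd u (vadd v w) = vadd (vadd u v) w.
Proof. by apply: eq_from_tnth => i; rewrite !vE addrA. Qed.

Lemma vaddAC u v w : vadd (vadd u v) w = vadd (vadd u w) v.
Proof. by rewrite -!vaddA [vadd v w]vaddC. Qed.

Lemma vadd0 u : vadd u vzero = u.
Proof. by apply: eq_from_tnth => i; rewrite !vE addr0. Qed.

Lemma measurable_tuple {d} {T : measurableType d} (f : 'I_N -> T -> R) :
  (forall i, measurable_fun setT (f i)) ->
  measurable_fun setT (fun w => [tuple f i w | i < N] : V).
Proof.
move=> mf; apply/measurable_fun_tnthP => i.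
by apply: eq_measurable_fun (mf i) => w _ /=; rewrite tnth_mktuple.
Qed.

Lemma measurable_vadd {d} {T : measurableType d} (f g : T -> V) :
  measurable_fun setT f -> measurable_fun setT g ->
  measurable_fun setT (fun w => vadd (f w) (g w)).
Proof.
move=> mf mg; apply: measurable_tuple => i; apply: measurable_funD.
- exact: (measurable_fun_tnthP f).1.
- exact: (measurable_fun_tnthP g).1.
Qed.

Lemma measurable_vscale {d} {T : measurableType d} (f : T -> R) (g : T -> V) :
  measurable_fun setT f -> measurable_fun setT g ->
  measurable_fun setT (fun w => vscale (f w) (g w)).
Proof.
move=> mf mg; apply: measurable_tuple => i; apply: measurable_funM => //.
exact: (measurable_fun_tnthP g).1.
Qed.

Definition nnmeas (G : V -> \bar R) :=
  measurable_fun setT G /\ forall u, (0 <= G u)%E.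

Section shift_mean.
Context {d} {T : measurableType d} (P : probability T R).

(** Convolution with the law of [X] as an operator. Keeping the shift [u] free is what makes
    induction over independent summands possible. *)
Definition shift_mean (X : T -> V) (G : V -> \bar R) (u : V) : \bar R :=
  (\int[P]_w G (vadd u (X w)))%E.

Lemma measurable_shift (X : T -> V) G : measurable_fun setT X -> nnmeas G ->
  measurable_fun setT (fun z : V * T => G (vadd z.1 (X z.2))).
Proof.
move=> mX [mG _]; apply: (measurableT_comp mG).
by apply: measurable_vadd => //; exact: measurableT_comp.
Qed.

Lemma measurable_shift1 (X : T -> V) G u : measurable_fun setT X -> nnmeas G ->
  measurable_fun setT (fun w => G (vadd u (X w))).
Proof.
by move=> mX [mG _]; apply: (measurableT_comp mG); exact: measurable_vadd.
Qed.

Lemma nnmeas_shift_mean (X : T -> V) G : measurable_fun setT X -> nnmeas G ->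
  nnmeas (shift_mean X G).
Proof.
move=> mX nG; split; last by move=> u; apply: integral_ge0 => w _; exact: nG.2.
exact: (measurable_integral_tonelli P (fun u w => G (vadd u (X w)))
  (measurable_shift _ _ mX nG) (fun _ _ => nG.2 _)).
Qed.

Lemma shift_mean_vadd (X Y : T -> V) G u :
  measurable_fun setT X -> measurable_fun setT Y -> independent_pair P Y X ->
  nnmeas G ->
  shift_mean (fun w => vadd (X w) (Y w)) G u = shift_mean Y (shift_mean X G) u.
Proof.
move=> mX mY XY nG; rewrite /shift_mean.
transitivity (\int[P]_w G (vadd (vadd u (Y w)) (X w)))%E.
  by apply: eq_integral => w _; rewrite vaddA vaddAC.
rewrite (integral_independent_pair P Y X (fun y x => G (vadd (vadd u y) x)))//.
- apply: (measurableT_comp nG.1); apply: measurable_vadd => //.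
  exact: measurable_vadd.
- by move=> x y; exact: nG.2.
Qed.

Lemma le_shift_mean (X Y : T -> V) G H u :
  measurable_fun setT X -> measurable_fun setT Y -> nnmeas G -> nnmeas H ->
  (forall w, G (vadd u (X w)) <= H (vadd u (Y w)))%E ->
  (shift_mean X G u <= shift_mean Y H u)%E.
Proof.
move=> mX mY nG nH GH; apply: ge0_le_integral => //.
- by move=> w _; exact: nG.2.
- exact: measurable_shift1.
- exact: measurable_shift1.
Qed.

End shift_mean.

(** The two averages run over separate variables and the shifts add, so this is Tonelli. It lets any
    operator be moved innermost in the exchange argument. *)
Lemma shift_meanC {d1 d2} {T1 : measurableType d1} {T2 : measurableType d2}
    (P1 : probability T1 R) (P2 : probability T2 R) (X : T1 -> V) (Y : T2 -> V)
    G u :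
  measurable_fun setT X -> measurable_fun setT Y -> nnmeas G ->
  shift_mean P1 X (shift_mean P2 Y G) u = shift_mean P2 Y (shift_mean P1 X G) u.
Proof.
move=> mX mY nG; rewrite /shift_mean.
under [RHS]eq_integral do under eq_integral do rewrite vaddAC.
apply: (tonelli_swap P1 P2 (fun w1 w2 => G (vadd (vadd u (X w1)) (Y w2)))).
- apply: (measurableT_comp nG.1); apply: measurable_vadd.
    by apply: measurable_vadd => //; exact: measurableT_comp.
  exact: measurableT_comp.
- by move=> x y; exact: nG.2.
Qed.

(** The heat semigroup along [v]: convolution with the law of [z v] for a standard normal [z]. *)
Definition gline v : (V -> \bar R) -> V -> \bar R :=
  shift_mean gauss1 (fun z => vscale z v).

Lemma measurable_line v : measurable_fun setT (fun z : R => vscale z v).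
Proof. exact: measurable_vscale. Qed.

Lemma nnmeas_gline v G : nnmeas G -> nnmeas (gline v G).
Proof. by move=> nG; apply: nnmeas_shift_mean => //; exact: measurable_line. Qed.

Lemma glineC v1 v2 G u : nnmeas G -> gline v1 (gline v2 G) u = gline v2 (gline v1 G) u.
Proof. by move=> nG; apply: shift_meanC => //; exact: measurable_line. Qed.

Lemma gline_conv a b v G u : nnmeas G ->
  gline (vscale a v) (gline (vscale b v) G) u =
  gline (vscale (Num.sqrt (a ^+ 2 + b ^+ 2)) v) G u.
Proof.
move=> nG; rewrite /gline /shift_mean.
have E c z w : vadd w (vscale z (vscale c v)) = vadd w (vscale (c * z) v).
  by apply: eq_from_tnth => i; rewrite !vE; ring.
have E2 x y w : vadd (vadd w (vscale x v)) (vscale y v) = vadd w (vscale (x + y) v).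
  by apply: eq_from_tnth => i; rewrite !vE; ring.
under eq_integral do under eq_integral do rewrite !E E2.
under [RHS]eq_integral do rewrite !E.
apply: (gauss1_conv (fun z => G (vadd u (vscale z v)))).
  by apply: measurable_shift1 => //; exact: measurable_line.
by move=> x; exact: nG.2.
Qed.

Lemma glineN v G u : nnmeas G -> gline (vscale (-1) v) G u = gline v G u.
Proof.
move=> nG; rewrite /gline /shift_mean.
rewrite -[RHS](ge0_integral_gauss1N (fun z => G (vadd u (vscale z v)))).
- apply: eq_integral => z _; congr (G (vadd u _)).
  by apply: eq_from_tnth => i; rewrite !vE; ring.
- by apply: measurable_shift1 => //; exact: measurable_line.
- by move=> x; exact: nG.2.
Qed.

(** Convolution with the law of the sum of [z_j vs_j], [j < k], for independent standard normals
    [z_j]. As it mentions no underlying probability space, it identifies Gaussian vectors living on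
    different ones. *)
Fixpoint glines (vs : nat -> V) k (G : V -> \bar R) : V -> \bar R :=
  if k is k'.+1 then gline (vs k') (glines vs k' G) else G.

Lemma nnmeas_glines vs k G : nnmeas G -> nnmeas (glines vs k G).
Proof. by move=> nG; elim: k => //= k IH; exact: nnmeas_gline. Qed.

Lemma eq_glines vs k G H : G =1 H -> glines vs k G =1 glines vs k H.
Proof.
move=> GH; elim: k => //= k IH u; rewrite /gline /shift_mean.
by apply: eq_integral => z _; exact: IH.
Qed.

Lemma glines_gline vs k v G u : nnmeas G ->
  glines vs k (gline v G) u = gline v (glines vs k G) u.
Proof.
move=> nG; elim: k u => //= k IH u.
rewrite glineC; last exact: nnmeas_glines.
by rewrite /gline /shift_mean; apply: eq_integral => z _; exact: IH.
Qed.

(** The operators commute, so the two averages along each direction can be brought together, where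
    [gline_conv] adds their variances. *)
Lemma glines_conv a b vs k G u : nnmeas G ->
  glines (fun j => vscale a (vs j)) k (glines (fun j => vscale b (vs j)) k G) u =
  glines (fun j => vscale (Num.sqrt (a ^+ 2 + b ^+ 2)) (vs j)) k G u.
Proof.
move=> nG; elim: k u => //= k IH u.
have nk c : nnmeas (glines (fun j => vscale c (vs j)) k G) by exact: nnmeas_glines.
transitivity (gline (vscale a (vs k)) (gline (vscale b (vs k))
    (glines (fun j => vscale a (vs j)) k (glines (fun j => vscale b (vs j)) k G))) u).
  by apply: eq_integral => z _; rewrite glines_gline.
rewrite gline_conv; last by apply: nnmeas_glines.
by apply: eq_integral => z _; exact: IH.
Qed.

Lemma glinesN vs k G u : nnmeas G ->
  glines (fun j => vscale (-1) (vs j)) k G u = glines vs k G u.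
Proof.
move=> nG; elim: k u => //= k IH u.
rewrite glineN; last exact: nnmeas_glines.
by apply: eq_integral => z _; exact: IH.
Qed.

Section gaussian_vector.
Context {d} {T : measurableType d} (P : probability T R) {n : nat}.
Variables (a : T -> 'rV[R]_n) (vs : nat -> V).
Hypothesis ga : standard_gaussian P a.

Definition gpart k (w : T) : V :=
  [tuple \sum_(j < n | (j < k)%N) a w 0 j * tnth (vs j) i | i < N].

Lemma measurable_coord j : measurable_fun setT (fun w => a w 0 j).
Proof. by have [] := ga.1 j. Qed.

Lemma measurable_gpart_wrt d' (S : measurableType d') (X : S -> 'rV[R]_n) k :
  (forall j : 'I_n, (j < k)%N -> measurable_fun setT (fun w => X w 0 j)) ->
  measurable_fun setT (fun w =>
    [tuple \sum_(j < n | (j < k)%N) X w 0 j * tnth (vs j) i | i < N] : V).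
Proof.
move=> mX; apply: measurable_tuple => i.
have -> : (fun w => \sum_(j < n | (j < k)%N) X w 0 j * tnth (vs j) i) =
    (fun w => \sum_(j < n) if (j < k)%N then X w 0 j * tnth (vs j) i else 0).
  by apply/funext => w; rewrite big_mkcond.
apply: measurable_sum => j; case jk : (j < k)%N; last exact: measurable_cst.
by apply: measurable_funM => //; exact: mX.
Qed.

Lemma measurable_gpart k : measurable_fun setT (gpart k).
Proof. exact: (measurable_gpart_wrt _ T a k (fun j _ => measurable_coord j)). Qed.

(** Induction over coordinates: the last one is independent of the earlier ones and has law
    [gauss1], hence contributes one [gline]. *)
Lemma shift_mean_gpart k G u : nnmeas G -> (k <= n)%N ->
  shift_mean P (gpart k) G u = glines vs k G u.
Proof.
move=> nG; elim: k u => [u _|k IH u kn].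
  rewrite /shift_mean /=.
  under eq_integral => w _.
    rewrite (_ : vadd _ _ = u); last first.
      apply: eq_from_tnth => i; rewrite tnth_vadd tnth_mktuple big_pred0 ?addr0//.
    over.
  by rewrite integral_cst_probability.
pose k' := Ordinal kn.
pose F := fun j : 'I_n => sigma_of (fun w => a w 0 j : R).
have mF j A : F j A -> measurable A.
  by move=> [B mB <-]; exact: measurable_coord.
have mX : measurable_fun setT (fun w => vscale (a w 0 k') (vs k)).
  by apply: measurable_vscale => //; exact: measurable_coord.
pose Jk := [set j : 'I_n | (j < k)%N]%SET.
have mk : measurable_fun (setT : set (g_sigma_algebraType (group_generators F Jk)))
    (gpart k).
  apply: (measurable_gpart_wrt _ (g_sigma_algebraType (group_generators F Jk)) a k)
    => j jk.
  apply: (@measurable_group R _ _ T R 'I_n F _ j); first by rewrite inE.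
  by move=> A mA; exists A => //; rewrite setTI.
have ma : measurable_fun
    (setT : set (g_sigma_algebraType (group_generators F [set k']%SET)))
    (fun w => a w 0 k').
  apply: (@measurable_group R _ _ T R 'I_n F _ k'); first by rewrite inE.
  by move=> A mA; exists A => //; rewrite setTI.
transitivity (shift_mean P (fun w => vadd (gpart k w) (vscale (a w 0 k') (vs k))) G u).
  apply: eq_integral => w _; congr (G (vadd u _)); apply: eq_from_tnth => i.
  by rewrite !vE !tnth_mktuple (sum_ord_ltS _ k').
rewrite shift_mean_vadd//; last 2 first.
- exact: measurable_gpart.
- apply: (independent_pair_groups P F [set k']%SET Jk).
  + exact: ga.2.
  + by move=> j; exact: sigma_of_sigma_algebra.
  + exact: mF.
  + by move=> j; rewrite !inE => /eqP ->; rewrite ltnn.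
  + exact: measurable_vscale.
  + exact: mk.
rewrite /= /gline /shift_mean.
rewrite (integral_has_law P gauss1 (fun w => a w 0 k')
  (fun z : R => \int[P]_w0 G (vadd (vadd u (vscale z (vs k))) (gpart k w0)))%E).
- by apply: eq_integral => z _; apply: IH; exact: ltnW.
- exact: ga.1.
- have [mG _] := nnmeas_shift_mean P (gpart k) G (measurable_gpart k) nG.
  by apply: (measurableT_comp mG); apply: measurable_vadd => //; exact: measurable_line.
- by move=> x; apply: integral_ge0 => w _; exact: nG.2.
Qed.

End gaussian_vector.

End vectors.

(** * Maximum functional and Hoeffding's inequality *)

(** From [expR x <= (1 - x)^-1], since [(1 - x) * (1 + x + 2 * x ^+ 2) = 1 + x ^+ 2 * (1 - 2 * x)]
    is at least 1 on this range. *)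
Lemma expR_le_quadratic {R : realType} (x : R) : `|x| <= 2^-1 ->
  expR x <= 1 + x + 2 * x ^+ 2.
Proof.
rewrite ler_norml => /andP[x1 x2].
have y0 : 0 < 1 - x by lra.
have : expR x <= (1 - x)^-1.
  by rewrite -[x in expR x]opprK expRN lef_pV2 ?posrE ?expR_gt0// expR_ge1Dx.
move=> /le_trans; apply; rewrite -[_^-1]mul1r ler_pdivrMr//.
have : 0 <= x ^+ 2 * (1 - 2 * x) by rewrite mulr_ge0 ?sqr_ge0//; lra.
nra.
Qed.

Section bounded.
Context {R : realType} {d} {T : measurableType d} (P : probability T R).

Lemma bounded_integrable (f : T -> R) (B : R) : measurable_fun setT f ->
  (forall w, `|f w| <= B) -> P.-integrable setT (EFin \o f).
Proof.
move=> mf fB; apply: measurable_bounded_integrable => //.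
  by rewrite ltey_eq fin_num_measure.
exists B; split; first exact: num_real.
by move=> c Bc w _ /=; apply: le_trans (fB w) (ltW Bc).
Qed.

Lemma bounded_fine (f : T -> R) (B : R) : measurable_fun setT f ->
  (forall w, `|f w| <= B) ->
  (\int[P]_w (f w)%:E)%E = (\int[P]_w f w)%:E.
Proof.
move=> mf fB; rewrite /Rintegral fineK//.
by apply: integrable_fin_num => //; exact: bounded_integrable mf fB.
Qed.

Lemma Rintegral_prob_cst (c : R) : \int[P]_w c = c.
Proof. by rewrite /Rintegral integral_cst_probability. Qed.

Lemma le_Rintegral_bounded (f g : T -> R) (B C : R) :
  measurable_fun setT f -> measurable_fun setT g ->
  (forall w, `|f w| <= B) -> (forall w, `|g w| <= C) ->
  (forall w, f w <= g w) -> \int[P]_w f w <= \int[P]_w g w.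
Proof.
move=> mf mg fB gC fg; apply: le_Rintegral => //.
- exact: bounded_integrable mf fB.
- exact: bounded_integrable mg gC.
Qed.

(** Oscillation at most 1 puts [f - c] in [[-1, 1]], and [l <= 2^-1] keeps the exponent where the
    quadratic bound on [expR] holds; the linear term then has mean zero. The constant 2 is not
    sharp, but any numerical one serves. *)
Lemma hoeffding (f : T -> R) (B l : R) : measurable_fun setT f ->
  (forall w, `|f w| <= B) -> (forall w w', f w - f w' <= 1) ->
  0 <= l <= 2^-1 ->
  (\int[P]_w (expR (l * f w))%:E <= (expR (l * \int[P]_w f w + 2 * l ^+ 2))%:E)%E.
Proof.
move=> mf fB osc /andP[l0 l2]; set c := \int[P]_w f w.
have If := bounded_integrable f B mf fB.
have cf w : `|f w - c| <= 1.
  rewrite ler_norml; apply/andP; split.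
    rewrite lerBrDl -lerBrDr opprK -(Rintegral_prob_cst (f w + 1)).
    apply: (le_Rintegral_bounded _ _ B `|f w + 1|) => // w'.
    by have := osc w' w; lra.
  rewrite lerBlDr -lerBlDl -(Rintegral_prob_cst (f w - 1)).
  apply: (le_Rintegral_bounded _ _ `|f w - 1| B) => // w'.
  by have := osc w w'; lra.
have mlf : measurable_fun setT (fun w => l * f w) by exact: measurable_funM.
have mfc : measurable_fun setT (fun w => l * (f w - c)).
  by apply: measurable_funM => //; exact: measurable_funB.
have bfc w : `|l * (f w - c)| <= 2^-1.
  by rewrite normrM ger0_norm//; have := cf w; have := normr_ge0 (f w - c); nra.
have key : \int[P]_w expR (l * (f w - c)) <= 1 + 2 * l ^+ 2.
  have E : \int[P]_w (1 + 2 * l ^+ 2 + l * (f w - c)) = 1 + 2 * l ^+ 2.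
    rewrite RintegralD//; last 2 first.
    - by apply: (bounded_integrable _ `|1 + 2 * l ^+ 2|).
    - exact: bounded_integrable mfc bfc.
    rewrite Rintegral_prob_cst RintegralZl//; last first.
      by apply: (bounded_integrable _ 1) => //; exact: measurable_funB.
    rewrite RintegralB//; last first.
      by apply: (bounded_integrable _ `|c|).
    by rewrite Rintegral_prob_cst subrr mulr0 addr0.
  rewrite -E; apply: (le_Rintegral_bounded _ _ (expR 1) (1 + 2 * l ^+ 2 + 2^-1)).
  - exact: measurableT_comp.
  - exact: measurable_funD.
  - move=> w; rewrite ger0_norm ?expR_ge0// ler_expR.
    have /(le_trans (ler_norm _)) := bfc w; lra.
  - move=> w; apply: le_trans (ler_normD _ _) _; rewrite lerD//.
    by rewrite ger0_norm// addr_ge0// mulr_ge0// sqr_ge0.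
  - move=> w; apply: le_trans (expR_le_quadratic _ (bfc w)) _.
    rewrite exprMn; have : (f w - c) ^+ 2 <= 1.
      by rewrite -real_normK ?num_real// expr_le1.
    have := sqr_ge0 l; nra.
have E2 w : (expR (l * f w))%:E = ((expR (l * c))%:E * (expR (l * (f w - c)))%:E)%E.
  by rewrite -EFinM -expRD; congr (expR _)%:E; ring.
under eq_integral do rewrite E2.
have mexp : measurable_fun setT (fun w => expR (l * (f w - c))).
  exact: measurableT_comp.
rewrite ge0_integralZl//; last 1 first.
- exact/measurable_EFinP.
rewrite (bounded_fine _ (expR 1))//; last first.
  move=> w; rewrite ger0_norm ?expR_ge0// ler_expR.
  have /(le_trans (ler_norm _)) := bfc w; lra.
rewrite -EFinM lee_fin expRD ler_pM2l ?expR_gt0//.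
exact: le_trans key (expR_ge1Dx _).
Qed.

End bounded.

(** * Maximum of a vector and two-point contraction *)

Section maxp.
Context {R : realType} {N : nat}.
Notation V := (N.-tuple R).
Implicit Types u v : V.

(* The baseline 0 keeps every integrand nonnegative, so that Tonelli applies
   without integrability side conditions. *)
Definition maxp u : R := \big[Order.max/0]_(i < N) tnth u i.

Lemma maxp_ge0 u : 0 <= maxp u.
Proof. exact: bigmax_ge_id. Qed.

Lemma le_maxp u i : tnth u i <= maxp u.
Proof. exact: le_bigmax. Qed.

Lemma maxp_le u c : 0 <= c -> (forall i, tnth u i <= c) -> maxp u <= c.
Proof. by move=> c0 uc; apply: bigmax_le => // i _; exact: uc. Qed.

Lemma maxp_attained u : maxp u = 0 \/ exists i, maxp u = tnth u i.
Proof.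
rewrite /maxp; elim/big_ind: _ => [|x y|i _]; first by left.
- by move=> hx hy; rewrite /Order.max; case: ifP.
- by right; exists i.
Qed.

Lemma maxp_shift u v c : 0 <= c -> (forall i, tnth u i <= tnth v i + c) ->
  maxp u <= maxp v + c.
Proof.
move=> c0 uv; apply: maxp_le; first by rewrite addr_ge0// maxp_ge0.
by move=> i; apply: le_trans (uv i) _; rewrite lerD2r le_maxp.
Qed.

Lemma measurable_maxp {d} {T : measurableType d} (f : T -> V) :
  measurable_fun setT f -> measurable_fun setT (fun w => maxp (f w)).
Proof.
move=> mf; rewrite /maxp; elim: (index_enum _) => [|i s IH].
  rewrite (_ : (fun _ => _) = cst 0); first exact: measurable_cst.
  by apply/funext => w; rewrite big_nil.
rewrite (_ : (fun _ => _) = (fun w => tnth (f w) i) \max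
    (fun w => \big[Order.max/0]_(j <- s) tnth (f w) j)).
  apply: measurable_maxr => //.
  exact: (measurable_fun_tnthP f).1.
by apply/funext => w; rewrite big_cons.
Qed.

Definition emaxp u : \bar R := (maxp u)%:E.

Lemma nnmeas_emaxp : nnmeas emaxp.
Proof.
split; last by move=> u; rewrite lee_fin maxp_ge0.
by apply/measurable_EFinP; exact: measurable_maxp.
Qed.

Definition expmaxp l u : \bar R := (expR (l * maxp u))%:E.

Lemma nnmeas_expmaxp l : nnmeas (expmaxp l).
Proof.
split; last by move=> u; rewrite lee_fin expR_ge0.
apply/measurable_EFinP; apply: measurableT_comp => //.
by apply: measurable_funM => //; exact: measurable_maxp.
Qed.

(* If [i] and [j] attain the two maxima on the left, the two sign patterns on the
   right provide [u_i + u_j + 2 |x_i - x_j|], and likewise for [x']. *)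
Lemma maxp_contraction u (f f' x x' : V) :
  (forall i, `|tnth f i| <= `|tnth x i|) ->
  (forall i, `|tnth f' i| <= `|tnth x' i|) ->
  (forall i j, `|tnth f i - tnth f j| <= `|tnth x i - tnth x j|) ->
  (forall i j, `|tnth f' i - tnth f' j| <= `|tnth x' i - tnth x' j|) ->
  2 * (maxp (vadd u (vadd f' (vscale (-1) f))) +
       maxp (vadd u (vadd f (vscale (-1) f')))) <=
  (maxp (vadd u (vscale 2 x)) + maxp (vadd u (vscale (-2) x))) +
  (maxp (vadd u (vscale 2 x')) + maxp (vadd u (vscale (-2) x'))).
Proof.
move=> fx fx' fxx fxx'.
set a := maxp (vadd u (vscale 2 x)); set b := maxp (vadd u (vscale (-2) x)).
set a' := maxp (vadd u (vscale 2 x')); set b' := maxp (vadd u (vscale (-2) x')).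
have ai i : tnth u i + 2 * tnth x i <= a
  by have := le_maxp (vadd u (vscale 2 x)) i; rewrite !vE.
have bi i : tnth u i + -2 * tnth x i <= b
  by have := le_maxp (vadd u (vscale (-2) x)) i; rewrite !vE.
have ai' i : tnth u i + 2 * tnth x' i <= a'
  by have := le_maxp (vadd u (vscale 2 x')) i; rewrite !vE.
have bi' i : tnth u i + -2 * tnth x' i <= b'
  by have := le_maxp (vadd u (vscale (-2) x')) i; rewrite !vE.
have a0 : 0 <= a by exact: maxp_ge0.
have b0 : 0 <= b by exact: maxp_ge0.
have a0' : 0 <= a' by exact: maxp_ge0.
have b0' : 0 <= b' by exact: maxp_ge0.
have one y : `|y| = y \/ `|y| = - y :> R.
  by case: (lerP 0 y) => y0; [left; rewrite ger0_norm|right; rewrite ltr0_norm].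
(* For the cases where one maximum on the left is the baseline 0: the right sign of [x] gives the
   bound, and the other maximum enters only through its nonnegativity. *)
have d1 i : tnth u i + 2 * `|tnth x i| <= a + b.
  by have := ai i; have := bi i; case: (one (tnth x i)) => ->; lra.
have d1' i : tnth u i + 2 * `|tnth x' i| <= a' + b'.
  by have := ai' i; have := bi' i; case: (one (tnth x' i)) => ->; lra.
have d2 i j : tnth u i + tnth u j + 2 * `|tnth x i - tnth x j| <= a + b.
  have := ai i; have := bi i; have := ai j; have := bi j.
  by case: (one (tnth x i - tnth x j)) => ->; lra.
have d2' i j : tnth u i + tnth u j + 2 * `|tnth x' i - tnth x' j| <= a' + b'.
  have := ai' i; have := bi' i; have := ai' j; have := bi' j.
  by case: (one (tnth x' i - tnth x' j)) => ->; lra.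
have ub (y z : R) : `|y| <= z -> - z <= y <= z by rewrite ler_norml.
case: (maxp_attained (vadd u (vadd f' (vscale (-1) f)))) => [->|[i ->]];
case: (maxp_attained (vadd u (vadd f (vscale (-1) f')))) => [->|[j ->]]; rewrite ?vE.
- lra.
- move: (d1 j) (d1' j) (ub _ _ (fx j)) (ub _ _ (fx' j)) => ? ? /andP[? ?] /andP[? ?]; lra.
- move: (d1 i) (d1' i) (ub _ _ (fx i)) (ub _ _ (fx' i)) => ? ? /andP[? ?] /andP[? ?]; lra.
- move: (d2 i j) (d2' i j) (ub _ _ (fxx i j)) (ub _ _ (fxx' i j)).
  by move=> ? ? /andP[? ?] /andP[? ?]; lra.
Qed.

End maxp.

(** * Concentration and symmetrization *)

Section double_integral.
Context {R : realType} {d} {T : measurableType d} (P : probability T R).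
Variables (H : T -> T -> \bar R) (S : T -> \bar R).
Hypotheses (mH : measurable_fun setT (fun z : T * T => H z.1 z.2))
  (H0 : forall x y, (0 <= H x y)%E)
  (mS : measurable_fun setT S) (S0 : forall x, (0 <= S x)%E).
Hypothesis HS : forall x y, (2%:E * (H x y + H y x) <= S x + S y)%E.

(** Integrate [HS] over both variables; by Tonelli [H x y] and [H y x] contribute equally. Doubled
    sums are kept because nothing may be cancelled while the integrals can be infinite. *)
Lemma double_integral_le_symmetric :
  (2%:E * (\int[P]_x \int[P]_y H x y + \int[P]_x \int[P]_y H x y) <=
   \int[P]_x S x + \int[P]_x S x)%E.
Proof.
have mH' : measurable_fun setT (fun z : T * T => H z.2 z.1).
  have ms : measurable_fun setT (fun z : T * T => (z.2, z.1)) by exact: measurable_fun_pair.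
  exact: (measurableT_comp mH ms).
have m1 : measurable_fun setT (fun x => \int[P]_y H x y)%E.
  exact: measurable_integral_tonelli mH H0.
have m2 : measurable_fun setT (fun x => \int[P]_y H y x)%E.
  exact: (measurable_integral_tonelli P (fun x y => H y x) mH' (fun _ _ => H0 _ _)).
have mpair (x : T) : measurable_fun setT (fun y : T => (x, y)) by exact: pair1_measurable.
have ms x : measurable_fun setT (H x) by exact: (measurableT_comp mH (mpair x)).
have ms' x : measurable_fun setT (fun y => H y x).
  exact: (measurableT_comp mH' (mpair x)).
have mD x : measurable_fun setT (fun y => H x y + H y x)%E by exact: emeasurable_funD.
have D0 x y : (0 <= H x y + H y x)%E by rewrite adde_ge0.
have -> : (\int[P]_x \int[P]_y H x y + \int[P]_x \int[P]_y H x y =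
    \int[P]_x \int[P]_y (H x y + H y x))%E.
  rewrite [X in (_ + X)%E = _](tonelli_swap P P H mH H0) -ge0_integralD//.
  - by apply: eq_integral => x _; rewrite -ge0_integralD.
  - by move=> x _; exact: integral_ge0.
  - by move=> x _; exact: integral_ge0.
have mDD : measurable_fun setT (fun x => \int[P]_y (H x y + H y x))%E.
  apply: (measurable_integral_tonelli P (fun x y => H x y + H y x)%E) => //.
  exact: emeasurable_funD.
have mSS x : measurable_fun setT (fun y => S x + S y)%E by exact: emeasurable_funD.
have Sint x : (\int[P]_y (S x + S y) = S x + \int[P]_y S y)%E.
  by rewrite ge0_integralD// integral_cst_probability.
have IS0 : (0 <= \int[P]_y S y)%E by exact: integral_ge0.
have -> : (\int[P]_x S x + \int[P]_x S x = \int[P]_x \int[P]_y (S x + S y))%E.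
  transitivity (\int[P]_x (S x + \int[P]_y S y))%E.
    by rewrite ge0_integralD// integral_cst_probability.
  by apply: eq_integral => x _; rewrite Sint.
rewrite -ge0_integralZl//; last by move=> x _; exact: integral_ge0.
apply: ge0_le_integral => //.
- by move=> x _; rewrite mule_ge0//; exact: integral_ge0.
- exact: measurable_funeM.
- rewrite (_ : (fun _ => _) = fun x => S x + \int[P]_y S y)%E; last by apply/funext.
  exact: emeasurable_funD.
move=> x _; rewrite -ge0_integralZl//.
apply: ge0_le_integral => //.
- by move=> y _; rewrite mule_ge0.
- exact: measurable_funeM.
Qed.

End double_integral.

(** * Exponential moments and exchange for partial sums *)

Section partial_sums.
Context {R : realType} {N m : nat} {d} {T : measurableType d}.
Variable P : probability T R.
Notation V := (N.-tuple R).
Implicit Types (X : 'I_m -> T -> V) (G : V -> \bar R) (u : V).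

Definition psum X (k : nat) (w : T) : V :=
  [tuple \sum_(i < m | (i < k)%N) tnth (X i w) j | j < N].

Lemma tnth_psum X k w j :
  tnth (psum X k w) j = \sum_(i < m | (i < k)%N) tnth (X i w) j.
Proof. by rewrite tnth_mktuple. Qed.

Lemma psumS X (k : 'I_m) w : psum X k.+1 w = vadd (psum X k w) (X k w).
Proof.
by apply: eq_from_tnth => j; rewrite tnth_vadd !tnth_psum (sum_ord_ltS _ k).
Qed.

Lemma psum0 X w : psum X 0 w = vzero.
Proof. by apply: eq_from_tnth => j; rewrite tnth_psum vE big_pred0. Qed.

Lemma measurable_psum_wrt {d'} {S : measurableType d'} (X : 'I_m -> S -> V) k :
  (forall i : 'I_m, (i < k)%N -> measurable_fun setT (X i)) ->
  measurable_fun setT (fun w =>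
    [tuple \sum_(i < m | (i < k)%N) tnth (X i w) j | j < N] : V).
Proof.
move=> mX; apply: measurable_tuple => j.
have -> : (fun w => \sum_(i < m | (i < k)%N) tnth (X i w) j) =
    (fun w => \sum_(i < m) if (i < k)%N then tnth (X i w) j else 0).
  by apply/funext => w; rewrite big_mkcond.
apply: measurable_sum => i; case ik : (i < k)%N; last exact: measurable_cst.
exact: (measurable_fun_tnthP _).1 (mX _ ik) j.
Qed.

Lemma measurable_psum X k : (forall i, measurable_fun setT (X i)) ->
  measurable_fun setT (psum X k).
Proof. by move=> mX; apply: measurable_psum_wrt. Qed.

Lemma shift_mean_psum0 X G u : shift_mean P (psum X 0) G u = G u.
Proof.
rewrite /shift_mean; under eq_integral do rewrite psum0 vadd0.
by rewrite integral_cst_probability.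
Qed.

Lemma shift_mean_psumS X G u (k : 'I_m) :
  (forall i, measurable_fun setT (X i)) ->
  independent_pair P (X k) (psum X k) -> nnmeas G ->
  shift_mean P (psum X k.+1) G u =
  shift_mean P (X k) (shift_mean P (psum X k) G) u.
Proof.
move=> mX iX nG; rewrite -shift_mean_vadd//; last exact: measurable_psum.
by apply: eq_integral => w _; rewrite psumS.
Qed.

Section mcdiarmid.
Variable X : 'I_m -> T -> V.
Hypotheses (mX : forall i, measurable_fun setT (X i))
  (X1 : forall i w j, `|tnth (X i w) j| <= 1)
  (oscX : forall i w w' j, tnth (X i w) j - tnth (X i w') j <= 1)
  (indX : forall k : 'I_m, independent_pair P (X k) (psum X k)).

Lemma norm_psum_le k w j : `|tnth (psum X k w) j| <= m%:R.
Proof.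
rewrite tnth_psum big_mkcond; apply: le_trans (ler_norm_sum _ _ _) _.
rewrite -[m in leRHS]card_ord -sum1_card natr_sum; apply: ler_sum => i _.
by case: ifP => // _; rewrite normr0.
Qed.

Lemma maxp_psum_le k u w : `|maxp (vadd u (psum X k w))| <= maxp u + m%:R.
Proof.
rewrite ger0_norm ?maxp_ge0//; apply: maxp_shift => // i; rewrite vE lerD2l.
exact: le_trans (ler_norm _) (norm_psum_le _ _ _).
Qed.

Lemma measurable_maxp_psum k u :
  measurable_fun setT (fun w => maxp (vadd u (psum X k w))).
Proof.
by apply: measurable_maxp; apply: measurable_vadd => //; exact: measurable_psum.
Qed.

Lemma shift_mean_psum_emaxp k u : shift_mean P (psum X k) emaxp u =
  (\int[P]_w maxp (vadd u (psum X k w)))%:E.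
Proof.
exact: (bounded_fine P _ _ (measurable_maxp_psum k u) (maxp_psum_le k u)).
Qed.

(** Induction on the number of summands, for all shifts at once. Given the newest summand, the mean
    of the maximum is [W] at the shifted point; it oscillates by at most 1, because [maxp] moves by
    at most 1 when every coordinate grows by at most 1. Hoeffding therefore charges [2 * l ^+ 2] per
    summand. *)
Lemma mcdiarmid l k u : 0 <= l <= 2^-1 -> (k <= m)%N ->
  (shift_mean P (psum X k) (expmaxp l) u <=
   (expR (l * \int[P]_w maxp (vadd u (psum X k w)) + 2 * l ^+ 2 * k%:R))%:E)%E.
Proof.
move=> l01; elim: k u => [u _|k IH u km].
  rewrite shift_mean_psum0 mulr0 addr0 lee_fin ler_expR.
  under eq_Rintegral do rewrite psum0 vadd0.
  by rewrite Rintegral_prob_cst.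
pose k' := Ordinal km.
pose W v := \int[P]_w maxp (vadd v (psum X k w)).
have nW : nnmeas (fun v => (W v)%:E).
  rewrite (_ : (fun _ => _) = shift_mean P (psum X k) emaxp).
    by apply: nnmeas_shift_mean; [exact: measurable_psum|exact: nnmeas_emaxp].
  by apply/funext => v; rewrite shift_mean_psum_emaxp.
pose f w := W (vadd u (X k' w)).
have mf : measurable_fun setT f.
  have := measurable_shift1 (X k') _ u (mX k') nW.
  by move/measurable_EFinP.
have W0 v : 0 <= W v by apply: Rintegral_ge0 => w _; exact: maxp_ge0.
have fB w : `|f w| <= maxp u + 1 + m%:R.
  rewrite ger0_norm; last exact: W0.
  rewrite -(Rintegral_prob_cst P (maxp u + 1 + m%:R)).
  apply: (le_Rintegral_bounded P _ _ (maxp (vadd u (X k' w)) + m%:R)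
    `|maxp u + 1 + m%:R|) => //.
  - exact: measurable_maxp_psum.
  - exact: maxp_psum_le.
  - move=> w'; apply: le_trans (ler_norm _) _; apply: le_trans (maxp_psum_le _ _ _) _.
    rewrite lerD2r; apply: maxp_shift => // i; rewrite vE lerD2l.
    exact: le_trans (ler_norm _) (X1 _ _ _).
have osc w w' : f w - f w' <= 1.
  rewrite lerBlDl -(Rintegral_prob_cst P 1) -RintegralD//; last 2 first.
  - exact: (bounded_integrable P _ _ (measurable_maxp_psum k _) (maxp_psum_le k _)).
  - by apply: (bounded_integrable P _ `|1|).
  apply: (le_Rintegral_bounded P _ _ (maxp (vadd u (X k' w)) + m%:R)
      (maxp (vadd u (X k' w')) + m%:R + 1)) => //.
  - exact: measurable_maxp_psum.
  - by apply: measurable_funD => //; exact: measurable_maxp_psum.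
  - exact: maxp_psum_le.
  - move=> w0; apply: le_trans (ler_normD _ _) _; rewrite normr1 lerD2r.
    exact: maxp_psum_le.
  - move=> w0; apply: maxp_shift => // i; rewrite !vE.
    by have := oscX k' w w' i; lra.
(* Averaging [W] over the newest summand recovers the full mean, so the linear terms of the exponent
   match exactly. *)
have fE : \int[P]_w f w = \int[P]_w maxp (vadd u (psum X k.+1 w)).
  apply: EFin_inj; rewrite -(bounded_fine P _ _ mf fB) -shift_mean_psum_emaxp.
  rewrite (shift_mean_psumS _ _ _ k')//; last exact: nnmeas_emaxp.
  by apply: eq_integral => w _; rewrite shift_mean_psum_emaxp.
rewrite (shift_mean_psumS _ _ _ k')//; last exact: nnmeas_expmaxp.
have mexp : measurable_fun setT (fun w => expR (l * f w)).
  by apply: measurableT_comp => //; exact: measurable_funM.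
apply: (@le_trans _ _ (\int[P]_w ((expR (2 * l ^+ 2 * k%:R))%:E * (expR (l * f w))%:E))%E).
  apply: ge0_le_integral => //.
  - by move=> w _; apply: integral_ge0 => w' _; rewrite lee_fin expR_ge0.
  - apply: measurable_shift1 => //; apply: nnmeas_shift_mean; first exact: measurable_psum.
    exact: nnmeas_expmaxp.
  - by apply: emeasurable_funM => //; exact/measurable_EFinP.
  - move=> w _; apply: le_trans (IH _ (ltnW km)) _.
    by rewrite -EFinM -expRD addrC.
rewrite ge0_integralZl//; last by exact/measurable_EFinP.
apply: le_trans (lee_wpmul2l _ (hoeffding P f _ l mf fB osc l01)) _.
  by rewrite lee_fin expR_ge0.
rewrite -EFinM -expRD lee_fin ler_expR fE mulrSr; lra.
Qed.

End mcdiarmid.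

(** Lindeberg's exchange: replace the earlier summands by induction, commute so that the average
    over the newest [X] is innermost, replace it there by that over [Y], and commute back. Hence the
    one-step hypothesis at every shift [v]. *)
Lemma shift_mean_psum_le X Y k u :
  (forall i, measurable_fun setT (X i)) -> (forall i, measurable_fun setT (Y i)) ->
  (forall i : 'I_m, independent_pair P (X i) (psum X i)) ->
  (forall i : 'I_m, independent_pair P (Y i) (psum Y i)) ->
  (forall i v, shift_mean P (X i) emaxp v <= shift_mean P (Y i) emaxp v)%E ->
  (k <= m)%N ->
  (shift_mean P (psum X k) emaxp u <= shift_mean P (psum Y k) emaxp u)%E.
Proof.
move=> mX mY indX indY XY; have nE := @nnmeas_emaxp R N.
elim: k u => [u _|k IH u km]; first by rewrite !shift_mean_psum0.
pose k' := Ordinal km.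
have mpX := measurable_psum X k mX; have mpY := measurable_psum Y k mY.
have nX := nnmeas_shift_mean P _ _ mpX nE.
have nY := nnmeas_shift_mean P _ _ mpY nE.
have EX := shift_mean_psumS X emaxp u k' mX (indX k') nE.
have EY := shift_mean_psumS Y emaxp u k' mY (indY k') nE.
have CX := shift_meanC P P (X k') (psum Y k) emaxp u (mX k') mpY nE.
have CY := shift_meanC P P (Y k') (psum Y k) emaxp u (mY k') mpY nE.
have nX' := nnmeas_shift_mean P _ _ (mX k') nE.
have nY' := nnmeas_shift_mean P _ _ (mY k') nE.
rewrite [leLHS]EX [leRHS]EY.
apply: le_trans (le_shift_mean P _ _ _ _ u (mX k') (mX k') nX nY _) _.
  by move=> w; exact/IH/ltnW.
rewrite [leLHS]CX [leRHS]CY.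
apply: (le_shift_mean P _ _ _ _ u mpY mpY nX' nY') => w.
exact: XY.
Qed.

Section symmetrization.
Variables (p : 'I_m -> V) (psi Y : 'I_m -> T -> V).
Hypotheses (mpsi : forall i, measurable_fun setT (psi i))
  (mY : forall i, measurable_fun setT (Y i))
  (psi01 : forall i w j, 0 <= tnth (psi i w) j <= 1)
  (pE : forall i j, tnth (p i) j = \int[P]_w tnth (psi i w) j)
  (psiY : forall i w j, `|tnth (psi i w) j| <= `|tnth (Y i w) j|)
  (psiYY : forall i w j j', `|tnth (psi i w) j - tnth (psi i w) j'| <=
     `|tnth (Y i w) j - tnth (Y i w) j'|)
  (symY : forall i G u, nnmeas G ->
     shift_mean P (fun w => vscale (-2) (Y i w)) G u =
     shift_mean P (fun w => vscale 2 (Y i w)) G u).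

Let X i w := vadd (p i) (vscale (-1) (psi i w)).
Let Y2 i w := vscale 2 (Y i w).

Let mX i : measurable_fun setT (X i).
Proof. by apply: measurable_vadd => //; exact: measurable_vscale. Qed.

Let mY2 i : measurable_fun setT (Y2 i).
Proof. exact: measurable_vscale. Qed.

(** Jensen inserts the ghost copy, [p i] being the mean of [psi i]. Integrated over both copies,
    [maxp_contraction] trades their difference for [2 Y] and [-2 Y], whose averages agree by
    [symY]. *)
Lemma symmetrization_step i u :
  (shift_mean P (X i) emaxp u <= shift_mean P (Y2 i) emaxp u)%E.
Proof.
pose D w w' := vadd (psi i w') (vscale (-1) (psi i w)).
have nE := @nnmeas_emaxp R N.
have psi1 w j : `|tnth (psi i w) j| <= 1.
  by have /andP[? ?] := psi01 i w j; rewrite ger0_norm.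
have mpj j : measurable_fun setT (fun w => tnth (psi i w) j).
  exact: (measurable_fun_tnthP (psi i)).1.
have mD w : measurable_fun setT (D w).
  by apply: measurable_vadd => //; exact: measurable_vscale.
have bD w w' : `|maxp (vadd u (D w w'))| <= maxp u + 2.
  rewrite ger0_norm ?maxp_ge0//; apply: maxp_shift => // j; rewrite !vE.
  by have /andP[? ?] := psi01 i w j; have /andP[? ?] := psi01 i w' j; lra.
have mDD : measurable_fun setT (fun z : T * T => emaxp (vadd u (D z.1 z.2))).
  apply: (measurableT_comp nE.1); apply: measurable_vadd => //.
  by apply: measurable_vadd; [|apply: measurable_vscale => //]; exact: measurableT_comp.
have mDD' : measurable_fun setT (fun z : T * T => emaxp (vadd u (D z.2 z.1))).
  apply: (measurableT_comp nE.1); apply: measurable_vadd => //.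
  by apply: measurable_vadd; [|apply: measurable_vscale => //]; exact: measurableT_comp.
have jensen w : (emaxp (vadd u (X i w)) <= \int[P]_w' emaxp (vadd u (D w w')))%E.
  rewrite (bounded_fine P (fun w' => maxp (vadd u (D w w'))) (maxp u + 2))//; last first.
    by apply: measurable_maxp; exact: measurable_vadd.
  rewrite lee_fin; apply: maxp_le; first by apply: Rintegral_ge0 => w' _; exact: maxp_ge0.
  move=> j; rewrite !vE pE.
  have -> : tnth u j + (\int[P]_w tnth (psi i w) j + -1 * tnth (psi i w) j) =
      \int[P]_w' (tnth u j - tnth (psi i w) j + tnth (psi i w') j).
    rewrite RintegralD//.
    - by rewrite Rintegral_prob_cst; ring.
    - by apply: (bounded_integrable P _ `|tnth u j - tnth (psi i w) j|).
    - exact: (bounded_integrable P _ 1).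
  apply: (le_Rintegral_bounded P _ _ (`|tnth u j - tnth (psi i w) j| + 1) (maxp u + 2)) => //.
  - exact: measurable_funD.
  - by apply: measurable_maxp; exact: measurable_vadd.
  - by move=> w'; apply: le_trans (ler_normD _ _) _; rewrite lerD2l.
  - move=> w'; have := le_maxp (vadd u (D w w')) j; rewrite !vE; lra.
have m1 : measurable_fun setT (fun w => \int[P]_w' emaxp (vadd u (D w w')))%E.
  exact: (measurable_integral_tonelli P (fun w w' => emaxp (vadd u (D w w')))
    mDD (fun _ _ => nE.2 _)).
have e0 (v : V) : (0 <= emaxp v)%E by exact: nE.2.
set A := (\int[P]_w \int[P]_w' emaxp (vadd u (D w w')))%E.
have XA : (shift_mean P (X i) emaxp u <= A)%E.
  by apply: ge0_le_integral => //; exact: measurable_shift1.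
have A0 : (0 <= A)%E by apply: integral_ge0 => w _; exact: integral_ge0.
apply: (le_trans XA).
set B := shift_mean P (Y2 i) emaxp u.
have B0 : (0 <= B)%E by apply: integral_ge0.
pose S w := (emaxp (vadd u (Y2 i w)) + emaxp (vadd u (vscale (-2) (Y i w))))%E.
have mYm : measurable_fun setT (fun w => emaxp (vadd u (vscale (-2) (Y i w)))).
  by apply: measurable_shift1 => //; exact: measurable_vscale.
have mYp : measurable_fun setT (fun w => emaxp (vadd u (Y2 i w))).
  exact: measurable_shift1.
have mS : measurable_fun setT S by exact: emeasurable_funD.
have S0 w : (0 <= S w)%E by rewrite adde_ge0.
have SB : (\int[P]_w S w = B + B)%E.
  by rewrite ge0_integralD//; congr (_ + _)%E; exact: symY.
(* Each of the two signs of [Y], on each of the two copies, averages to [B]: this is four times the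
   claim. *)
have four : (2%:E * (A + A) <= (B + B) + (B + B))%E.
  rewrite -SB; apply: (double_integral_le_symmetric P 
    (fun w w' => emaxp (vadd u (D w w'))) S mDD (fun _ _ => e0 _) mS S0).
  move=> w w'; rewrite /S /emaxp -!EFinD -EFinM lee_fin.
  have := maxp_contraction u _ _ _ _ (psiY i w) (psiY i w') (psiYY i w) (psiYY i w').
  by rewrite /D /Y2; lra.
(* Cancelling the factor 4 needs finite values: for infinite [B] the claim is trivial, and then an
   infinite [A] contradicts [four]. *)
move: B0 A0 four; case: (B) => [b| |]//; last by move=> *; rewrite leey.
case: (A) => [a| |]//; last by move=> _ _; rewrite /= gt0_muley ?lte_fin.
by rewrite !lee_fin => _ _; lra.
Qed.

Hypotheses (indX : forall k : 'I_m, independent_pair P (X k) (psum X k))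
  (indY : forall k : 'I_m, independent_pair P (Y2 k) (psum Y2 k)).

(** Chernoff's bound for [maxp]: the exponential moment comes from [mcdiarmid], the mean in it from
    the exchange of [X] for [2 Y]. *)
Lemma empirical_process_tail (kappa l s : R) : 0 <= l <= 2^-1 ->
  (shift_mean P (psum Y2 m) emaxp vzero <= (m%:R * kappa)%:E)%E ->
  (P [set w | (exists j, m%:R * s <= tnth (psum X m w) j)%R] <=
   (expR (m%:R * (l * kappa + 2 * l ^+ 2 - l * s)))%:E)%E.
Proof.
move=> l01 hk.
have X1 i w j : `|tnth (X i w) j| <= 1.
  have /andP[? ?] := psi01 i w j.
  have : 0 <= tnth (p i) j <= 1.
    rewrite pE; apply/andP; split.
      by apply: Rintegral_ge0 => w' _; have /andP[] := psi01 i w' j.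
    rewrite -(Rintegral_prob_cst P 1); apply: (le_Rintegral_bounded P _ _ 1 1) => //.
    - exact: (measurable_fun_tnthP (psi i)).1.
    - by move=> w'; have /andP[? ?] := psi01 i w' j; rewrite ger0_norm.
    - by move=> w'; rewrite normr1.
    - by move=> w'; have /andP[] := psi01 i w' j.
  by move=> /andP[? ?]; rewrite !vE ler_norml; apply/andP; split; lra.
have oscX i w w' j : tnth (X i w) j - tnth (X i w') j <= 1.
  have /andP[? ?] := psi01 i w j; have /andP[? ?] := psi01 i w' j.
  by rewrite !vE; lra.
have := mcdiarmid X mX X1 oscX indX l m vzero l01 (leqnn m).
have := shift_mean_psum_le X Y2 m vzero mX mY2 indX indY symmetrization_step (leqnn m).
rewrite shift_mean_psum_emaxp// => /le_trans /(_ hk); rewrite lee_fin.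
set W := \int[P]_w _ => Wk mcd.
set E := [set w | _].
have l0 : 0 <= l by case/andP: l01.
have mE : measurable E.
  rewrite (_ : E = \bigcup_(j in [set: 'I_N])
      ((fun w => tnth (psum X m w) j) @^-1` `[m%:R * s, +oo[)).
    apply: fin_bigcup_measurable; first exact: finite_finset.
    move=> j _.
    rewrite -[X in measurable X]setTI.
    have := (measurable_fun_tnthP (psum X m)).1 (measurable_psum X m mX) j.
    by move=> /(_ measurableT _ (measurable_itv `[m%:R * s, +oo[)).
  apply/seteqP; split => [w [j jw]|w [j _]] /=.
    by exists j => //=; rewrite in_itv/= andbT.
  by rewrite in_itv/= andbT => jw; exists j.
have mem := measurable_shift1 (psum X m) (expmaxp l) vzero
  (measurable_psum X m mX) (nnmeas_expmaxp l).
have le1 : ((expR (l * (m%:R * s)))%:E * P E <= shift_mean P (psum X m) (expmaxp l) vzero)%E.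
  have -> : ((expR (l * (m%:R * s)))%:E * P E = \int[P]_(w in E) (expR (l * (m%:R * s)))%:E)%E.
    by rewrite integral_cst.
  apply: (@le_trans _ _ (\int[P]_(w in E) expmaxp l (vadd vzero (psum X m w)))%E).
    apply: ge0_le_integral => //.
    - exact: measurable_funTS.
    - move=> w; rewrite /E /= => -[j jw]; rewrite lee_fin ler_expR ler_wpM2l//.
      by apply: le_trans jw _; apply: le_trans (le_maxp _ j); rewrite !vE add0r.
  apply: ge0_subset_integral => //.
  by move=> w _; rewrite lee_fin expR_ge0.
have := le_trans le1 mcd.
have -> : expR (m%:R * (l * kappa + 2 * l ^+ 2 - l * s)) =
    (expR (l * (m%:R * s)))^-1 * expR (l * (m%:R * kappa) + 2 * l ^+ 2 * m%:R).
  by rewrite -expRN -expRD; congr expR; ring.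
move=> le2.
have fP : P E \is a fin_num by exact: fin_num_measure.
rewrite -(fineK fP) lee_fin; move: le2; rewrite -(fineK fP) -EFinM lee_fin => le2.
rewrite -ler_pdivrMl ?invr_gt0 ?expR_gt0// invrK; apply: le_trans le2 _.
by rewrite ler_expR lerD2r ler_wpM2l.
Qed.

End symmetrization.

End partial_sums.

(** * Taylor bounds for convex functions *)

Section one_variable.
Context {R : realType}.
Implicit Types (L : R -> R).

Lemma is_derive_affine_comp L (c b x : R) :
  derivable L (c + x * b) 1 ->
  is_derive x 1 (fun tau => L (c + tau * b)) (b * L^`()%classic (c + x * b)).
Proof.
move=> dL; rewrite mulrC.
have d1 : is_derive x 1 (fun tau => c + tau * b) b.
  have -> : (fun tau : R => c + tau * b) = cst c + b \*: id.
    by apply/funext => y /=; rewrite /GRing.scale /= mulrC.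
  by apply: is_derive_eq; rewrite add0r /GRing.scale /= mulr1.
apply: (@is_derive1_comp R L (fun tau => c + tau * b)).
by apply: DeriveDef => //; rewrite derive1E.
Qed.

Lemma is_derive_within_continuous (f df : R -> R) (a b : R) :
  (forall x : R, is_derive x 1 f (df x)) -> {within `[a, b], continuous f}.
Proof.
move=> fdf; apply: continuous_subspaceT => x.
by apply: differentiable_continuous; apply/derivable1_diffP; exact: ex_derive.
Qed.

(** The second derivative is controlled on the segment only, which is all that [d2loss_lower_bound]
    can give. The mean value theorem is applied to the remainder [g], then to the derivative [k]
    along the segment. *)
Lemma taylor2_lower_bound L (v s C : R) :
  (forall x, derivable L x 1) -> (forall x, derivable L^`()%classic x 1) ->
  (forall x, 0 <= x <= 1 -> C <= L^`()%classic^`()%classic (v + x * s)) ->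
  C / 2 * s ^+ 2 <= L (v + s) - L v - L^`()%classic v * s.
Proof.
move=> dL dL' LC.
pose k x := s * L^`()%classic (v + x * s).
have dk (x : R) : is_derive x 1 k (s * (s * L^`()%classic^`()%classic (v + x * s))).
  exact: (is_deriveZ (V := R) (W := R) s (is_derive_affine_comp L^`()%classic v s x (dL' _))).
pose g x := L (v + x * s) - x * (s * L^`()%classic v) - C / 2 * s ^+ 2 * x ^+ 2.
have dg (x : R) : is_derive x 1 g (k x - s * L^`()%classic v - C * s ^+ 2 * x).
  have d1 := is_derive_affine_comp L v s x (dL _).
  have -> : g = (fun y => L (v + y * s)) - (s * L^`()%classic v) \*: id -
      (C / 2 * s ^+ 2) \*: (id * id).
    by apply/funext => y; rewrite /g !fctE /= /GRing.scale /=; ring.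
  apply: is_derive_eq.
  by rewrite /GRing.scale /= /k; field.
have [c] := MVT ltr01 (fun x _ => dg x) (is_derive_within_continuous _ _ 0 1 dg).
rewrite in_itv /= => /andP[c0 c1].
have [e] := MVT c0 (fun x _ => dk x) (is_derive_within_continuous _ _ 0 c dk).
rewrite in_itv /= => /andP[e0 e1].
rewrite {1 2}/k !subr0 mul0r addr0 => kE gE.
have Ce : C <= L^`()%classic^`()%classic (v + e * s)
  by apply: LC; rewrite ltW//= ltW// (lt_trans e1).
have : 0 <= (L^`()%classic^`()%classic (v + e * s) - C) * (s ^+ 2 * c).
  by rewrite mulr_ge0 ?subr_ge0// mulr_ge0 ?sqr_ge0// ltW.
move: gE; rewrite /g !mul0r !mul1r addr0 expr0n /= mulr0 expr1n mulr1 !subr0.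
have -> : k c = s * L^`()%classic v + s * (s * L^`()%classic^`()%classic (v + e * s)) * c.
  by rewrite -kE /k; ring.
nra.
Qed.

(** Convexity bounds difference quotients with step in []0, 1]] by [L (v + s) - L v], and the
    derivative is their limit from the right. *)
Lemma convex_tangent L (v s : R) :
  convex_function (E := R^o) setT L -> derivable L v 1 ->
  0 <= L (v + s) - L v - L^`()%classic v * s.
Proof.
move=> cL dL.
pose phi (tau : R) := L (v + tau * s).
have [d1 dE] : is_derive (0 : R) 1 phi (s * L^`()%classic v).
  have dL0 : derivable L (v + 0 * s) 1 by rewrite mul0r addr0.
  by have := is_derive_affine_comp L v s 0 dL0; rewrite mul0r addr0.
rewrite subr_ge0 mulrC -dE.
have cvr : (h^-1 *: ((phi \o shift 0) (h *: 1) - phi 0) : R^o) @[h --> 0^'+] -->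
    ('D_1 phi 0 : R^o).
  apply: cvg_trans d1; apply: cvg_app => A A0.
  suff : nbhs (0 : R) (fun x => 0 < x -> A x) by [].
  have : nbhs (0 : R) (fun x => x != 0 -> A x) by exact: A0.
  by apply: (@filterS _ (nbhs (0 : R))) => x Ax x0; apply: Ax; rewrite gt_eqF.
apply: (cvgr_to_le cvr).
near=> h.
have h0 : 0 < h by near: h; exact: nbhs_right_gt.
have h1 : h <= 1 by near: h; exact: nbhs_right_le.
rewrite /= /GRing.scale /= mulr1 addr0 /phi mul0r addr0 mulrC ler_pdivrMr//.
have : L (h * (v + s) + (1 - h) * v) <= h * L (v + s) + (1 - h) * L v.
  by apply: (cL (Itv01 (ltW h0) h1) (v + s) v); rewrite inE.
have -> : h * (v + s) + (1 - h) * v = v + h * s by ring.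
move=> H; rewrite lerBlDr; apply: le_trans H _.
by rewrite le_eqVlt; apply/orP; left; apply/eqP; ring.
Unshelve. all: by end_near.
Qed.

End one_variable.

(** * Gaussian processes *)

Section gaussian_processes.
Context {R : realType}.

Lemma dotC {n} (u v : 'rV[R]_n) : dot u v = dot v u.
Proof. by apply: eq_bigr => j _; rewrite mulrC. Qed.

Lemma dotDr {n} (u v w : 'rV[R]_n) : dot u (v + w) = dot u v + dot u w.
Proof. by rewrite -big_split; apply: eq_bigr => j _; rewrite mxE mulrDr. Qed.

Lemma dotZr {n} (c : R) (u v : 'rV[R]_n) : dot u (c *: v) = c * dot u v.
Proof. by rewrite mulr_sumr; apply: eq_bigr => j _; rewrite mxE mulrCA. Qed.

Lemma dotBr {n} (u v w : 'rV[R]_n) : dot u (v - w) = dot u v - dot u w.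
Proof. by rewrite -scaleN1r dotDr dotZr mulN1r. Qed.

Lemma norm2Z {n} (c : R) (u : 'rV[R]_n) : norm2 (c *: u) = `|c| * norm2 u.
Proof. by rewrite /norm2 dotZr dotC dotZr mulrA -expr2 sqrtrM ?sqr_ge0// sqrtr_sqr. Qed.

Lemma measurable_dot {d} {T : measurableType d} {n} (a : T -> 'rV[R]_n) h :
  (forall j, measurable_fun setT (fun w => a w 0 j)) ->
  measurable_fun setT (fun w => dot (a w) h).
Proof.
by move=> ma; apply: measurable_sum => j; exact: measurable_funM.
Qed.

Section lines.
Context {N : nat}.
Notation V := (N.-tuple R).

Lemma gline0 (v : V) G u : gline (vscale 0 v) G u = G u.
Proof.
rewrite /gline /shift_mean; under eq_integral => z _.
  rewrite (_ : vadd _ _ = u); last by apply: eq_from_tnth => i; rewrite !vE; ring.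
  over.
by rewrite integral_cst_probability.
Qed.

(** Parallel directions merge one by one and their variances add. On 1-tuples this yields the law of
    a single inner product. *)
Lemma glines_parallel (c : nat -> R) (v : V) k G u : nnmeas G ->
  glines (fun j => vscale (c j) v) k G u =
  gline (vscale (Num.sqrt (\sum_(j < k) c j ^+ 2)) v) G u.
Proof.
move=> nG; elim: k u => [u|k IH u]; first by rewrite big_ord0 sqrtr0 gline0.
rewrite /= big_ord_recr /= addrC.
have s0 : 0 <= \sum_(j < k) c j ^+ 2 by apply: sumr_ge0 => j _; exact: sqr_ge0.
transitivity (gline (vscale (c k) v)
    (gline (vscale (Num.sqrt (\sum_(j < k) c j ^+ 2)) v) G) u).
  by apply: eq_integral => z _; exact: IH.
rewrite -[X in _ + X](sqr_sqrtr s0).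
exact: (gline_conv (c k) (Num.sqrt (\sum_(j < k) c j ^+ 2)) v G u nG).
Qed.

Lemma glines0 k (G : V -> \bar R) u : glines (fun=> vzero) k G u = G u.
Proof.
elim: k u => //= k IH u.
have E : vzero = vscale 0 vzero :> V by apply: eq_from_tnth => i; rewrite !vE mul0r.
rewrite [X in gline X]E -[RHS](gline0 vzero).
by apply: eq_integral => z _; exact: IH.
Qed.

End lines.

(** [glines] takes its directions from a sequence over [nat]; the default fills the indices from [n]
    on, which [glines _ n] never reaches. *)
Definition ext {A} (x0 : A) {n} (x : 'I_n -> A) (j : nat) : A :=
  oapp x x0 (insub j).

Lemma extE {A} (x0 : A) n (x : 'I_n -> A) (i : 'I_n) : ext x0 x i = x i.
Proof. by rewrite /ext valK. Qed.

Definition gproc {n N} (h : 'I_N -> 'rV[R]_n) (g : 'rV[R]_n) : N.-tuple R :=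
  [tuple dot g (h j) | j < N].

(** The [k]-th direction collects the [k]-th entries of all [h j], because the process [dot g (h j)]
    is the sum over [k] of [g 0 k] times that vector. *)
Definition coords {n N} (c : R) (h : 'I_N -> 'rV[R]_n) : nat -> N.-tuple R :=
  fun k => vscale c (ext vzero (fun i => [tuple h j 0 i | j < N]) k).

Lemma gproc_gpart {d} {T : measurableType d} {n N} (a : T -> 'rV[R]_n)
    (h : 'I_N -> 'rV[R]_n) c w :
  vscale c (gproc h (a w)) = gpart a (coords c h) n w.
Proof.
apply: eq_from_tnth => j; rewrite vE !tnth_mktuple mulr_sumr.
rewrite [RHS](eq_bigl xpredT); last by move=> i; rewrite /= ltn_ord.
by apply: eq_bigr => i _; rewrite vE extE tnth_mktuple mulrCA.
Qed.

Lemma measurable_gproc {d} {T : measurableType d} {n N} (a : T -> 'rV[R]_n)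
    (h : 'I_N -> 'rV[R]_n) :
  (forall j, measurable_fun setT (fun w => a w 0 j)) ->
  measurable_fun setT (fun w => gproc h (a w)).
Proof. by move=> ma; apply: measurable_tuple => j; exact: measurable_dot. Qed.

Section gaussian.
Context {d} {T : measurableType d} (P : probability T R) {n N : nat}.
Variables (a : T -> 'rV[R]_n) (h : 'I_N -> 'rV[R]_n).
Hypothesis ga : standard_gaussian P a.

Lemma shift_mean_gproc c G u : nnmeas G ->
  shift_mean P (fun w => vscale c (gproc h (a w))) G u =
  glines (coords c h) n G u.
Proof.
move=> nG; rewrite -(shift_mean_gpart P a _ ga)//.
by apply: eq_integral => w _; rewrite gproc_gpart.
Qed.

Lemma shift_mean_gproc_sym G u : nnmeas G ->
  shift_mean P (fun w => vscale (-2) (gproc h (a w))) G u =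
  shift_mean P (fun w => vscale 2 (gproc h (a w))) G u.
Proof.
move=> nG; rewrite !shift_mean_gproc//.
rewrite -[RHS]glinesN//; congr (glines _ _ _ _); apply/funext => j.
by apply: eq_from_tnth => i; rewrite !vE; ring.
Qed.

End gaussian.

(** The case of one direction: on 1-tuples all coordinate directions are parallel, and their squared
    lengths sum to [dot h h]. *)
Lemma integral_gaussian_dot {d} {T : measurableType d} (P : probability T R)
    {n : nat} (a : T -> 'rV[R]_n) (h : 'rV[R]_n) (G : R -> \bar R) :
  standard_gaussian P a -> norm2 h = 1 ->
  measurable_fun setT G -> (forall x, 0 <= G x)%E ->
  (\int[P]_w G (dot (a w) h) = \int[gauss1]_z G z)%E.
Proof.
move=> ga h1 mG G0.
pose G' (u : 1.-tuple R) := G (tnth u ord0).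
have nG : nnmeas G'.
  split; last by move=> u; exact: G0.
  have mt : measurable_fun setT (fun u : 1.-tuple R => tnth u ord0) := measurable_tnth ord0.
  exact: (measurableT_comp mG mt).
have := shift_mean_gproc P a (fun _ : 'I_1 => h) ga 1 G' vzero nG.
have -> : coords 1 (fun _ : 'I_1 => h) = fun j => vscale (ext 0 (h 0) j) [tuple 1].
  apply/funext => j; apply: eq_from_tnth => i; rewrite !vE /ext.
  by case: insub => [k|] /=; rewrite ?tnth_mktuple ord1 (tnth_nth 0) /=; ring.
rewrite glines_parallel//.
have -> : \sum_(j < n) ext 0 (h 0) j ^+ 2 = dot h h.
  by apply: eq_bigr => j _; rewrite extE expr2.
rewrite [Num.sqrt _]h1 /gline /shift_mean /G' => E.
transitivity (\int[P]_w G (tnth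
  (vadd vzero (vscale 1 (gproc (fun _ : 'I_1 => h) (a w)))) ord0))%E.
  by apply: eq_integral => w _; rewrite !vE tnth_mktuple add0r mul1r.
rewrite E; apply: eq_integral => z _; rewrite !vE (tnth_nth 0) /=.
by rewrite add0r !mulr1.
Qed.

Section sums.
Context {d} {T : measurableType d} (P : probability T R) {n N m : nat}.
Variables (a : 'I_m -> T -> 'rV[R]_n) (h : 'I_N -> 'rV[R]_n).
Hypothesis ga : forall i, standard_gaussian P (a i).
Let Y2 i w := vscale 2 (gproc h (a i w)).
Hypothesis indY : forall k : 'I_m, independent_pair P (Y2 k) (psum Y2 k).

Let ma i j : measurable_fun setT (fun w => a i w 0 j).
Proof. by have [] := (ga i).1 j. Qed.

Let mY2 i : measurable_fun setT (Y2 i).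
Proof.
by apply: measurable_vscale; [exact: measurable_cst|exact: measurable_gproc].
Qed.

(** Each further summand [2 dot (a i) (h j)] adds [2 ^+ 2] to the squared scale, by independence and
    [glines_conv]. *)
Lemma shift_mean_psum_gproc k G u : nnmeas G -> (k <= m)%N ->
  shift_mean P (psum Y2 k) G u =
  glines (coords (Num.sqrt (4 * k%:R)) h) n G u.
Proof.
move=> nG; elim: k u => [u _|k IH u km].
  rewrite shift_mean_psum0 mulr0 sqrtr0.
  have -> : coords 0 h = fun=> vzero.
    by apply/funext => j; apply: eq_from_tnth => i; rewrite !vE mul0r.
  by rewrite glines0.
pose k' := Ordinal km.
have nk : nnmeas (shift_mean P (psum Y2 k) G).
  by apply: nnmeas_shift_mean => //; exact: measurable_psum.
have EY := shift_mean_psumS P Y2 G u k' mY2 (indY k') nG.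
have EG := shift_mean_gproc P (a k') h (ga k') 2 _ u nk.
transitivity (glines (coords 2 h) n (glines (coords (Num.sqrt (4 * k%:R)) h) n G) u).
  rewrite [LHS]EY [LHS]EG; apply: eq_glines => v; apply: IH; exact: ltnW.
have E : 2 ^+ 2 + Num.sqrt (4 * k%:R) ^+ 2 = 4 * k.+1%:R :> R.
  by rewrite sqr_sqrtr ?mulr_ge0// -natr1; ring.
rewrite -E; exact: glines_conv.
Qed.

(** [g] may live on another probability space than the [a i]; both sides reduce to the same iterated
    average. Positive homogeneity of [maxp] then extracts the scale. *)
Lemma shift_mean_psum_width {dG} {TG : measurableType dG}
    (PG : probability TG R) (g : TG -> 'rV[R]_n) : standard_gaussian PG g ->
  shift_mean P (psum Y2 m) emaxp vzero =
  ((Num.sqrt (4 * m%:R))%:E * \int[PG]_w emaxp (gproc h (g w)))%E.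
Proof.
move=> gg; have nE := @nnmeas_emaxp R N.
rewrite (shift_mean_psum_gproc m _ _ nE (leqnn m)).
rewrite -(shift_mean_gproc PG g h gg _ _ _ nE) -ge0_integralZl//.
- apply: eq_integral => w _; rewrite /emaxp -EFinM; congr _%:E.
  set s := Num.sqrt _; have s0 : 0 <= s by exact: sqrtr_ge0.
  rewrite /maxp -[RHS]/(s * _).
  elim/big_rec2: _ => [|i x y _ ->]; first by rewrite mulr0.
  by rewrite !vE add0r maxr_pMr.
- apply: (measurableT_comp nE.1); apply: measurable_gproc => j.
  by have [] := gg.1 j.
- by move=> w _; exact: nE.2.
Qed.

End sums.

End gaussian_processes.

(** * Gradient, tent function, dense sequences *)

Section gradient.
Context {R : realType} {m n : nat}.

Lemma derive_line (F : 'rV[R]_n -> R) (z v : 'rV[R]_n) :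
  'D_v F z = 'D_(1 : R) (fun tau : R => F (z + tau *: v)) 0.
Proof.
have E : (fun h : R => h^-1 *: ((F \o shift z) (h *: v) - F z)) =
    (fun h : R => h^-1 *: (((fun tau : R => F (z + tau *: v)) \o shift 0) (h *: 1) -
       F (z + 0 *: v))).
  apply/funext => h /=; rewrite scale0r !addr0 [h *: v + z]addrC.
  by have -> : h%:A = h by exact: mulr1.
by rewrite /derive E.
Qed.

Lemma dot_delta (u : 'rV[R]_n) j : dot u (delta_mx 0 j) = u 0 j.
Proof.
rewrite /dot (bigD1 j)//= big1 ?addr0 => [|i ij]; first by rewrite mxE !eqxx mulr1.
by rewrite mxE eqxx (negbTE ij) mulr0.
Qed.

(** [gradient] consists of partial derivatives only. The derivative is computed along every [v] at
    once; being linear in [v], the result can be summed over the basis. *)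
Lemma gradient_empirical_loss (L : R -> R -> R) (a : 'I_m -> 'rV[R]_n)
    (y : 'rV[R]_m) (z h : 'rV[R]_n) :
  (forall i v, derivable (L ^~ (y 0 i)) v 1) ->
  dot (gradient (empirical_loss L a y) z) h =
  m%:R^-1 * \sum_(i < m) dloss L (dot (a i) z) (y 0 i) * dot (a i) h.
Proof.
move=> dL.
have D v : 'D_v (empirical_loss L a y) z =
    m%:R^-1 * \sum_(i < m) dloss L (dot (a i) z) (y 0 i) * dot (a i) v.
  rewrite derive_line.
  have -> : (fun tau : R => empirical_loss L a y (z + tau *: v)) =
      m%:R^-1 \*: (\sum_(i < m) (fun tau : R => L (dot (a i) z + tau * dot (a i) v) (y 0 i))).
    apply/funext => tau /=; rewrite /empirical_loss fct_sumE /=; congr (_ * _).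
    by apply: eq_bigr => i _; rewrite dotDr dotZr.
  have di i : is_derive (0 : R) 1 (fun tau : R => L (dot (a i) z + tau * dot (a i) v) (y 0 i))
      (dot (a i) v * dloss L (dot (a i) z) (y 0 i)).
    have := is_derive_affine_comp (L ^~ (y 0 i)) (dot (a i) z) (dot (a i) v) 0 (dL i _).
    by rewrite mul0r addr0.
  have /(@is_deriveZ _ _ _ _ m%:R^-1)[_ ->] := is_derive_sum di.
  rewrite /GRing.scale /=; congr (_ * _).
  by apply: eq_bigr => i _; rewrite mulrC.
rewrite /dot; under eq_bigr do rewrite mxE D.
under eq_bigr do rewrite -mulrA mulr_suml.
rewrite -mulr_sumr exchange_big /=; congr (_ * _); apply: eq_bigr => i _.
rewrite mulr_sumr; apply: eq_bigr => j _.
by rewrite -/(dot _ _) dot_delta mulrA.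
Qed.

Lemma empirical_loss_bregman (L : R -> R -> R) (a : 'I_m -> 'rV[R]_n)
    (y : 'rV[R]_m) (z x : 'rV[R]_n) :
  (forall i v, derivable (L ^~ (y 0 i)) v 1) ->
  empirical_loss L a y x - empirical_loss L a y z -
    dot (gradient (empirical_loss L a y) z) (x - z) =
  m%:R^-1 * \sum_(i < m) (L (dot (a i) z + dot (a i) (x - z)) (y 0 i) -
    L (dot (a i) z) (y 0 i) - dloss L (dot (a i) z) (y 0 i) * dot (a i) (x - z)).
Proof.
move=> dL; rewrite gradient_empirical_loss// /empirical_loss -!mulrBr -!sumrB.
by congr (_ * _); apply: eq_bigr => i _; rewrite dotBr [dot (a i) z + _]addrC subrK.
Qed.

End gradient.

Section tent.
Context {R : realType}.

(** The lower edge [|u| = 1] of the support gives [tent u <= u ^+ 2]; the upper edge [|u| = 3]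
    bounds the increment [t * u] by [3 t], which keeps the argument of the second derivative inside
    [(-M, M)]. *)
Definition tent (u : R) : R := Num.max 0 (1 - `| `|u| - 2|).

Lemma tent_ge0 u : 0 <= tent u.
Proof. by rewrite /tent le_max lexx. Qed.

Lemma tent_le1 u : tent u <= 1.
Proof. by rewrite /tent ge_max ler01 gerBl normr_ge0. Qed.

Lemma tent_le_norm u : tent u <= `|u|.
Proof.
rewrite /tent ge_max normr_ge0 /= lerBlDr.
by have := ler_normB 2 `|u|; have := ler_norm (2 - `|u|); rewrite distrC; lra.
Qed.

Lemma tent_lipschitz u v : `|tent u - tent v| <= `|u - v|.
Proof.
have clip (x y : R) : `|Num.max 0 (1 - x) - Num.max 0 (1 - y)| <= `|x - y|.
  have k1 : x - y <= `|x - y| by exact: ler_norm.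
  have k2 : y - x <= `|x - y| by rewrite distrC ler_norm.
  have k0 := normr_ge0 (x - y).
  rewrite !maxEle; case: ifPn; rewrite -?ltNge => hx; case: ifPn;
    rewrite -?ltNge => hy; rewrite ler_norml; apply/andP; split; lra.
apply: le_trans (clip _ _) _; apply: le_trans (ler_dist_dist _ _) _.
by rewrite opprB addrA subrK; exact: ler_dist_dist.
Qed.

Lemma tent_support u : 0 < tent u -> 1 < `|u| < 3.
Proof.
rewrite /tent lt_max ltxx /= subr_gt0 ltr_norml => /andP[? ?].
by apply/andP; split; lra.
Qed.

Lemma tent_le_sqr u : tent u <= u ^+ 2.
Proof.
have := tent_ge0 u; rewrite le_eqVlt => /predU1P[<-|/[dup] + /tent_support/andP[u1 _]].
  exact: sqr_ge0.
move=> _; apply: (le_trans (tent_le1 u)).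
by rewrite -real_normK ?num_real// expr_ge1// ltW.
Qed.

Lemma measurable_tent : measurable_fun setT tent.
Proof.
apply: measurable_maxr => //; apply: measurable_funB => //.
apply: measurableT_comp => //; apply: measurable_funB => //.
Qed.

Definition tent_mean : R := \int[gauss1]_u tent u.

Lemma tent_meanE : (\int[gauss1]_u (tent u)%:E)%E = tent_mean%:E.
Proof.
apply: (bounded_fine gauss1 tent 1); first exact: measurable_tent.
by move=> u; rewrite ger0_norm ?tent_ge0// tent_le1.
Qed.

Lemma tent_mean_le1 : tent_mean <= 1.
Proof.
rewrite -(Rintegral_prob_cst gauss1 1).
apply: (le_Rintegral_bounded gauss1 _ _ 1 1) => //.
- exact: measurable_tent.
- by move=> u; rewrite ger0_norm ?tent_ge0// tent_le1.
- by move=> u; rewrite normr1.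
- exact: tent_le1.
Qed.

(** On [[3/2, 5/2]] the tent is at least 1/2 and the density at least its value at 3; [c] is the
    product of these two bounds. *)
Lemma tent_mean_gt0 : 0 < tent_mean.
Proof.
rewrite -lte_fin -tent_meanE ge0_integral_gauss1; last 2 first.
- by apply/measurable_EFinP; exact: measurable_tent.
- by move=> u; rewrite lee_fin tent_ge0.
pose c : R := 2^-1 * (normal_peak 1 * expR (- (3 ^+ 2 / 2))).
have c0 : 0 < c by rewrite !mulr_gt0 ?expR_gt0 ?normal_peak_gt0 ?oner_neq0.
pose I : set R := `[3 / 2, 5 / 2]%classic.
have mI : measurable I by exact: measurable_itv.
have lt0 : (0 < \int[lebesgue_measure]_(x in I) c%:E)%E.
  rewrite integral_cst//= /I lebesgue_measure_itv/= lte_fin.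
  have -> : 3 / 2 < 5 / 2 :> R by lra.
  rewrite -EFinB -EFinM lte_fin mulr_gt0//; lra.
apply: (lt_le_trans lt0).
have mtp : measurable_fun setT (fun x : R => (tent x)%:E * (normal_pdf 0 1 x)%:E)%E.
  by apply: emeasurable_funM; apply/measurable_EFinP;
    [exact: measurable_tent|exact: measurable_normal_pdf].
have tp0 (x : R) : (0 <= (tent x)%:E * (normal_pdf 0 1 x)%:E)%E.
  by rewrite mule_ge0// lee_fin ?tent_ge0 ?normal_pdf_ge0.
apply: (@le_trans _ _ (\int[lebesgue_measure]_(x in I) ((tent x)%:E * (normal_pdf 0 1 x)%:E))%E); last first.
  by apply: ge0_subset_integral.
apply: ge0_le_integral => //.
- by move=> x _; rewrite lee_fin ltW.
- exact: measurable_funTS.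
move=> x; rewrite /I /= in_itv /= => /andP[x1 x2].
rewrite -EFinM lee_fin gauss1_pdfE /c ler_pM//.
- by rewrite mulr_ge0 ?expR_ge0 ?normal_peak_ge0.
- rewrite /tent le_max; apply/orP; right; rewrite [`|x|]ger0_norm; last lra.
  by rewrite lerBrDl -lerBrDr ler_norml; apply/andP; split; lra.
- rewrite ler_pM2l ?normal_peak_gt0 ?oner_neq0// ler_expR lerN2 ler_pM2r ?invr_gt0//.
  by rewrite ler_pXn2r ?nnegrE//; lra.
Qed.

End tent.

Section dense.
Context {R : realType} {n : nat}.

(** [A] is arbitrary and may contain no rational point. For each rational vector and precision,
    encoded together as a natural number, a point of [A] that close is picked if there is one, and
    the default [x0] otherwise. *)
Lemma dense_sequence (A : set 'rV[R]_n) (x0 : 'rV[R]_n) : A x0 ->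
  exists h : nat -> 'rV[R]_n, (forall k, A (h k)) /\
    forall x, A x -> forall e, 0 < e -> exists k, forall j, `|h k 0 j - x 0 j| < e.
Proof.
move=> Ax0.
pose near_q (p : 'rV[rat]_n * nat) : set 'rV[R]_n :=
  [set y | A y /\ forall j, `|y 0 j - ratr (p.1 0 j)| < p.2.+1%:R^-1].
pose h k := if unpickle k is Some p then
  (if pselect (exists y, near_q p y) is left e then projT1 (cid e) else x0) else x0.
exists h; split => [k|x Ax e e0].
  rewrite /h; case: unpickle => // p; case: pselect => // ex.
  by case: cid => y [].
have [N Ne] : exists N : nat, N.+1%:R^-1 < e / 2.
  have e2 : 0 < e / 2 by rewrite divr_gt0.
  exists (Num.truncn (e / 2)^-1); rewrite invf_plt ?posrE//.
  exact: truncnS_gt.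
have N0 : 0 < N.+1%:R^-1 :> R by rewrite invr_gt0.
have /choice[q qx] : forall j, exists q : rat, `|x 0 j - ratr q| < N.+1%:R^-1.
  move=> j; have lt1 : x 0 j - N.+1%:R^-1 < x 0 j + N.+1%:R^-1 by rewrite ltrD2l gtrN.
  have [q /=] := rat_in_itvoo lt1; rewrite in_itv /= => /andP[q1 q2].
  by exists q; rewrite distrC ltr_distl q1 q2.
pose p : 'rV[rat]_n * nat := (\row_j q j, N).
exists (pickle p) => j; rewrite /h pickleK.
case: pselect => [ex|[]]; last by exists x; split => // i; rewrite mxE.
case: cid => y /= [Ay /(_ j)]; rewrite mxE => yq.
have := qx j; rewrite distrC => xq.
have := ler_distD (ratr (q j)) (y 0 j) (x 0 j) => H.
apply: le_lt_trans H _; apply: lt_trans (ltrD yq xq) _; rewrite /p /=.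
by rewrite [ltRHS]splitr ltrD.
Qed.

End dense.

(** * Measurement ensembles *)

Section ensemble.
Context {R : realType} {d dS : measure_display} {T : measurableType d}
  {S : measurableType dS} {P : probability T R} {Q : probability S R}
  {m n : nat}.
Variables (a : 'I_m -> T -> 'rV[R]_n) (xi : 'I_m -> T -> S).
Hypothesis haxi : measurement_ensemble P Q a xi.

Definition ensemble_algebra (k : 'I_m + 'I_m) : set_system T :=
  match k with
  | inl i => sigma_of_vector (a i)
  | inr i => sigma_of (xi i)
  end.
Notation F := ensemble_algebra.

Lemma ensemble_gaussian i : standard_gaussian P (a i).
Proof. by case: haxi. Qed.

Lemma ensemble_coord i j : measurable_fun setT (fun w => a i w 0 j).
Proof. by have [] := (ensemble_gaussian i).1 j. Qed.

Lemma ensemble_seed_law i : has_law P (xi i) Q.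
Proof. by case: haxi. Qed.

Lemma ensemble_seed i : measurable_fun setT (xi i).
Proof. by have [] := ensemble_seed_law i. Qed.

Lemma coord_sigma_of_vector i j A : measurable A ->
  sigma_of_vector (a i) ((fun w => a i w 0 j) @^-1` A).
Proof.
move=> mA; apply: sub_sigma_algebra; rewrite -bigcup_seq/=.
exists j => /=; first by rewrite mem_index_enum.
by exists A => //; rewrite setTI.
Qed.

Lemma ensemble_algebra_measurable k A : F k A -> measurable A.
Proof.
case: k => i /=; last by move=> [B mB <-]; exact: ensemble_seed.
apply: smallest_sub; first exact: sigma_algebra_measurable.
rewrite -bigcup_seq/= => B [j _ [C mC <-]]; exact: ensemble_coord.
Qed.

Lemma ensemble_algebra_sigma k : sigma_algebra setT (F k).
Proof.
by case: k => i; [exact: smallest_sigma_algebra|exact: sigma_of_sigma_algebra].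
Qed.

Lemma measurable_group_coord (J : {set 'I_m + 'I_m}) i j : inl i \in J ->
  measurable_fun (setT : set (g_sigma_algebraType (group_generators F J)))
    (fun w => a i w 0 j).
Proof.
move=> iJ; apply: (@measurable_group R _ _ T R _ F J (inl i)) => // A mA.
exact: coord_sigma_of_vector.
Qed.

Lemma measurable_group_seed (J : {set 'I_m + 'I_m}) i : inr i \in J ->
  measurable_fun (setT : set (g_sigma_algebraType (group_generators F J))) (xi i).
Proof.
move=> iJ; apply: (@measurable_group R _ _ T S _ F J (inr i)) => // A mA.
by exists A => //; rewrite setTI.
Qed.

(** One measurement owns both its vector [inl i] and its seed [inr i], so the two are selected
    together. *)
Definition obs_group (p : pred 'I_m) : {set 'I_m + 'I_m} :=
  [set k | match k with inl i => p i | inr i => p i end]%SET.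

Section functional_of_measurement.
Context {N : nat}.
Variable Z : 'I_m -> 'rV[R]_n -> S -> N.-tuple R.
Hypothesis mZ : forall i d' (T' : measurableType d') (b : T' -> 'rV[R]_n) (c : T' -> S),
  (forall j, measurable_fun setT (fun w => b w 0 j)) ->
  measurable_fun setT c -> measurable_fun setT (fun w => Z i (b w) (c w)).

(** [mZ] ranges over all source spaces because it is applied to [T] carrying the sigma-algebra of
    one measurement, and of the earlier ones. *)
Lemma independent_measurements (X := fun i w => Z i (a i w) (xi i w)) (k : 'I_m) :
  independent_pair P (X k) (psum X k).
Proof.
apply: (independent_pair_groups P F (obs_group (pred1 k)) (obs_group (fun i => (i < k)%N))).
- by have [_ _ h] := haxi; apply: h.
- exact: ensemble_algebra_sigma.
- exact: ensemble_algebra_measurable.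
- by move=> [i|i]; rewrite !inE => /eqP ->; rewrite ltnn.
- apply: (mZ _ _ (g_sigma_algebraType (group_generators F (obs_group (pred1 k))))).
    by move=> j; apply: measurable_group_coord; rewrite !inE.
  by apply: measurable_group_seed; rewrite !inE.
- apply: (measurable_psum_wrt 
    (S := g_sigma_algebraType (group_generators F (obs_group (fun i => (i < k)%N)))))
    => i ik.
  apply: (mZ _ _ (g_sigma_algebraType (group_generators F (obs_group (fun i => (i < k)%N))))).
    by move=> j; apply: measurable_group_coord; rewrite !inE.
  by apply: measurable_group_seed; rewrite !inE.
Qed.

End functional_of_measurement.

(** The seed is independent of the vector, and [dot (a i) x0] is standard normal for a unit [x0]:
    the pair has the law under which [f(g)] is defined. *)
Lemma integral_measurement (x0 : 'rV[R]_n) (i : 'I_m) (G : S * R -> \bar R) :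
  norm2 x0 = 1 -> measurable_fun setT G -> (forall z, 0 <= G z)%E ->
  (\int[P]_w G (xi i w, dot (a i w) x0) = \int[Q \x gauss1]_z G z)%E.
Proof.
move=> hx0 mG G0.
have mD : measurable_fun setT (fun w => dot (a i w) x0).
  by apply: measurable_dot => j; exact: ensemble_coord.
have ind : independent_pair P (xi i) (fun w => dot (a i w) x0).
  apply: (independent_pair_groups P F [set inr i]%SET [set inl i]%SET).
  - by have [_ _ h] := haxi; apply: h.
  - exact: ensemble_algebra_sigma.
  - exact: ensemble_algebra_measurable.
  - by move=> k; rewrite !inE => /eqP ->.
  - by apply: measurable_group_seed; rewrite !inE.
  - apply: (@measurable_dot R _ (g_sigma_algebraType (group_generators F
      [set inl i]%SET))) => j.
    by apply: measurable_group_coord; rewrite !inE.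
have mG' : measurable_fun setT (fun z : S * R => G (z.1, z.2)).
  by apply: eq_measurable_fun mG => -[].
rewrite (integral_independent_pair P (xi i) _ (fun s u => G (s, u))
  (ensemble_seed i) mD ind mG')//.
rewrite fubini_tonelli1//.
rewrite -(integral_has_law P Q (xi i) (fun s => \int[gauss1]_u G (s, u))%E).
- apply: eq_integral => w _.
  apply: (integral_gaussian_dot P (a i) x0 (fun u => G (xi i w, u))
    (ensemble_gaussian i) hx0) => //.
  have mp : measurable_fun setT (fun u : R => (xi i w, u)) by exact: pair1_measurable.
  exact: (measurableT_comp mG mp).
- exact: ensemble_seed_law.
- exact: (measurable_integral_tonelli gauss1 (fun s u => G (s, u)) mG').
- by move=> s; apply: integral_ge0.
Qed.

End ensemble.

(** * Uniform small-ball estimate *)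

Section small_ball.
Context {R : realType} {d dS : measure_display} {T : measurableType d}
  {S : measurableType dS} {P : probability T R} {Q : probability S R}
  {m n : nat}.
Variables (a : 'I_m -> T -> 'rV[R]_n) (xi : 'I_m -> T -> S).
Hypothesis haxi : measurement_ensemble P Q a xi.
Variables (x0 : 'rV[R]_n) (B : set (S * R)).
Hypotheses (hx0 : norm2 x0 = 1) (mB : measurable B).
Local Notation p0 := (@tent_mean R).
Hypothesis PB : ((Q \x gauss1) (~` B) <= (p0 / 2)%:E)%E.

Definition tent_count (h : 'rV[R]_n) (w : T) : R :=
  \sum_(i < m) tent (dot (a i w) h) * \1_B (xi i w, dot (a i w) x0).

Let mI C : measurable C -> measurable_fun setT (\1_C : S * R -> R).
Proof. by move=> mC; exact: measurable_indic. Qed.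

Let term (h : 'rV[R]_n) i w : R :=
  tent (dot (a i w) h) * \1_B (xi i w, dot (a i w) x0).

Lemma measurable_tent_term {d'} {T' : measurableType d'} (h : 'rV[R]_n)
    (b : T' -> 'rV[R]_n) (c : T' -> S) :
  (forall j, measurable_fun setT (fun w => b w 0 j)) ->
  measurable_fun setT c ->
  measurable_fun setT (fun w => tent (dot (b w) h) * \1_B (c w, dot (b w) x0) : R).
Proof.
move=> mb mc.
have md g : measurable_fun setT (fun w => dot (b w) g) by exact: measurable_dot.
apply: measurable_funM; first exact: (measurableT_comp measurable_tent (md h)).
have mp : measurable_fun setT (fun w => (c w, dot (b w) x0)).
  exact: measurable_fun_pair.
exact: (measurableT_comp (mI B mB) mp).
Qed.

Lemma tent_term_itv h i w : 0 <= term h i w <= 1.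
Proof.
rewrite /term indicE; case: (_ \in _); rewrite ?mulr0 ?mulr1 ?lexx ?ler01//.
by rewrite tent_ge0 tent_le1.
Qed.

Let mterm h i : measurable_fun setT (term h i).
Proof.
apply: measurable_tent_term; first by move=> j; exact: (ensemble_coord _ _ haxi).
exact: (ensemble_seed _ _ haxi).
Qed.

Let bterm h i w : `|term h i w| <= 1.
Proof. by have /andP[? ?] := tent_term_itv h i w; rewrite ger0_norm. Qed.

Lemma measurable_tent_count h : measurable_fun setT (tent_count h).
Proof. by apply: measurable_sum => i; exact: mterm. Qed.

(** [dot (a i) h] and the event [B] involve the same vector, so nothing factors. As [tent] is at
    most 1, discarding bad measurements lowers the mean [p0] by at most their probability
    [p0 / 2]. *)
Lemma tent_term_mean h i : norm2 h = 1 -> p0 / 2 <= \int[P]_w term h i w.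
Proof.
move=> h1.
have mdot g : measurable_fun setT (fun w => dot (a i w) g).
  by apply: measurable_dot => j; exact: (ensemble_coord _ _ haxi).
have mt : measurable_fun setT (fun w => tent (dot (a i w) h)).
  exact: (measurableT_comp measurable_tent (mdot h)).
have mp : measurable_fun setT (fun w => (xi i w, dot (a i w) x0)).
  by apply: measurable_fun_pair => //; exact: (ensemble_seed _ _ haxi).
have mBC : measurable (~` B) by exact: measurableC.
pose bad w : R := \1_(~` B) (xi i w, dot (a i w) x0).
have mbad : measurable_fun setT bad by exact: (measurableT_comp (mI _ mBC) mp).
have bbad w : `|bad w| <= 1.
  by rewrite /bad indicE; case: (_ \in _); rewrite ?normr1 ?normr0 ?ler01.
have bt w : `|tent (dot (a i w) h)| <= 1 by rewrite ger0_norm ?tent_ge0// tent_le1.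
have tE : \int[P]_w tent (dot (a i w) h) = p0.
  rewrite /Rintegral /tent_mean /Rintegral; congr fine.
  apply: (integral_gaussian_dot P (a i) h (fun u => (tent u)%:E)
    (ensemble_gaussian _ _ haxi i) h1).
    by apply/measurable_EFinP; exact: measurable_tent.
  by move=> u; rewrite lee_fin tent_ge0.
have bE : \int[P]_w bad w <= p0 / 2.
  rewrite -lee_fin -(bounded_fine P _ 1 mbad bbad).
  have := integral_measurement a xi haxi x0 i (fun z => (\1_(~` B) z)%:E) hx0.
  move=> ->; last 2 first.
  - by apply/measurable_EFinP; exact: measurable_indic.
  - by move=> z; rewrite lee_fin.
  have mBC' : @measurable _ (S * measurableTypeR R)%type (~` B) by exact: mBC.
  have -> : (\int[Q \x gauss1]_z (\1_(~` B) z)%:E = (Q \x gauss1) (~` B))%E.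
    transitivity ((Q \x gauss1) ((~` B) `&` setT))%E.
      exact: (integral_indic (Q \x gauss1)%E measurableT mBC').
    by rewrite setIT.
  exact: PB.
have le1 : \int[P]_w tent (dot (a i w) h) <= \int[P]_w (term h i w + bad w).
  apply: (le_Rintegral_bounded P _ _ 1 2) => //.
  - exact: measurable_funD.
  - move=> w; apply: le_trans (ler_normD _ _) _.
    by have := bterm h i w; have := bbad w; lra.
  - move=> w; rewrite /term /bad !indicE in_setC; case: (_ \in B) => /=.
      by rewrite mulr1 addr0.
    by rewrite mulr0 add0r tent_le1.
move: le1; rewrite tE RintegralD//; last 2 first.
- exact: (bounded_integrable P _ 1).
- exact: (bounded_integrable P _ 1).
by lra.
Qed.

Context {N : nat} (h : 'I_N -> 'rV[R]_n).
Hypothesis h1 : forall j, norm2 (h j) = 1.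

(** The mean count is at least [m p0 / 2], so a count of at most [m p0 / 4] forces a centred sum of
    at least [m p0 / 4], to which the tail bound applies. *)
Lemma small_ball_finite {dG} {TG : measurableType dG} (PG : probability TG R)
    (g : TG -> 'rV[R]_n) : standard_gaussian PG g ->
  (\int[PG]_w emaxp (gproc h (g w)) <= (Num.sqrt m%:R * (p0 / 32))%:E)%E ->
  (P [set w | exists j, (tent_count (h j) w <= m%:R * (p0 / 4))%R] <=
   (expR (- (p0 ^+ 2 / 256 * m%:R)))%:E)%E.
Proof.
move=> gg width.
have p00 : 0 < p0 by exact: tent_mean_gt0.
have p01 : p0 <= 1 by exact: tent_mean_le1.
pose psi (i : 'I_m) w : N.-tuple R := [tuple term (h j) i w | j < N].
pose Y (i : 'I_m) w := gproc h (a i w).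
pose p (i : 'I_m) : N.-tuple R := [tuple \int[P]_w term (h j) i w | j < N].
pose X i w := vadd (p i) (vscale (-1) (psi i w)).
have mpsi i : measurable_fun setT (psi i).
  by apply: measurable_tuple => j; exact: mterm.
have mY i : measurable_fun setT (Y i).
  by apply: measurable_gproc => j; exact: (ensemble_coord _ _ haxi).
have indY (k : 'I_m) : independent_pair P (fun w => vscale 2 (Y k w))
    (psum (fun i w => vscale 2 (Y i w)) k).
  apply: (independent_measurements a xi haxi (fun _ b _ => vscale 2 (gproc h b))).
  by move=> i d' T' b c mb mc; apply: measurable_vscale => //; exact: measurable_gproc.
have indX (k : 'I_m) : independent_pair P (X k) (psum X k).
  apply: (independent_measurements a xi haxi (fun i b c => vadd (p i) (vscale (-1)
    [tuple tent (dot b (h j)) * \1_B (c, dot b x0) | j < N]))).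
  move=> i d' T' b c mb mc; apply: measurable_vadd => //; apply: measurable_vscale => //.
  by apply: measurable_tuple => j; exact: measurable_tent_term.
have psi01 i w j : 0 <= tnth (psi i w) j <= 1.
  by rewrite tnth_mktuple; exact: tent_term_itv.
have pE i j : tnth (p i) j = \int[P]_w tnth (psi i w) j.
  by rewrite tnth_mktuple; apply: eq_Rintegral => w _; rewrite tnth_mktuple.
have c01 i w : 0 <= (\1_B (xi i w, dot (a i w) x0) : R) <= 1.
  by rewrite indicE; case: (_ \in _); rewrite ?lexx ?ler01.
have psiY i w j : `|tnth (psi i w) j| <= `|tnth (Y i w) j|.
  have /andP[c0 c1] := c01 i w.
  rewrite !tnth_mktuple normrM ger0_norm ?tent_ge0// (ger0_norm c0).
  by apply: le_trans (tent_le_norm _); rewrite ler_piMr// tent_ge0.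
have psiYY i w j j' : `|tnth (psi i w) j - tnth (psi i w) j'| <=
    `|tnth (Y i w) j - tnth (Y i w) j'|.
  have /andP[c0 c1] := c01 i w.
  rewrite !tnth_mktuple -mulrBl normrM (ger0_norm c0).
  by apply: le_trans (tent_lipschitz _ _); rewrite ler_piMr.
have symY i G u : nnmeas G -> shift_mean P (fun w => vscale (-2) (Y i w)) G u =
    shift_mean P (fun w => vscale 2 (Y i w)) G u.
  exact: (shift_mean_gproc_sym P (a i) h (ensemble_gaussian _ _ haxi i)).
have sm0 : 0 <= Num.sqrt m%:R :> R by exact: sqrtr_ge0.
have smE : Num.sqrt m%:R * Num.sqrt m%:R = m%:R :> R by rewrite -expr2 sqr_sqrtr.
(* The scale [2 sqrt m] of the Gaussian sum times the assumed width [sqrt m * p0 / 32]. *)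
have wk : (shift_mean P (psum (fun i w => vscale 2 (Y i w)) m) emaxp vzero <=
    (m%:R * (p0 / 16))%:E)%E.
  rewrite (shift_mean_psum_width P a h (ensemble_gaussian _ _ haxi) indY PG g gg).
  apply: le_trans (lee_wpmul2l _ width) _; first by rewrite lee_fin sqrtr_ge0.
  rewrite -EFinM lee_fin sqrtrM//.
  have -> : Num.sqrt 4 = 2 :> R.
    by rewrite (_ : 4 = 2 ^+ 2) ?sqrtr_sqr ?ger0_norm//; ring.
  have -> : 2 * Num.sqrt m%:R * (Num.sqrt m%:R * (p0 / 32)) =
    Num.sqrt m%:R * Num.sqrt m%:R * (p0 / 16) by field.
  by rewrite smE.
(* With [l = p0 / 32] the exponent per measurement is [p0 ^+ 2 * (1/512 + 1/512 - 4/512)], that is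
   [- p0 ^+ 2 / 256]. *)
have l01 : 0 <= p0 / 32 <= 2^-1 by apply/andP; split; lra.
have := empirical_process_tail P p psi Y mpsi mY psi01 pE psiY psiYY symY indX indY
  (p0 / 16) (p0 / 32) (p0 / 4) l01 wk.
have -> : m%:R * (p0 / 32 * (p0 / 16) + 2 * (p0 / 32) ^+ 2 - p0 / 32 * (p0 / 4)) =
    - (p0 ^+ 2 / 256 * m%:R) by field.
apply: le_trans; apply: le_measure.
- rewrite inE.
  rewrite (_ : [set w | _] = \bigcup_(j in [set: 'I_N])
      ((tent_count (h j)) @^-1` `]-oo, m%:R * (p0 / 4)])).
    apply: fin_bigcup_measurable; first exact: finite_finset.
    move=> j _; rewrite -[X in measurable X]setTI.
    by apply: (measurable_tent_count (h j)); [exact: measurableT|exact: measurable_itv].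
  apply/seteqP; split => [w [j jw]|w [j _]] /=.
    by exists j => //=; rewrite in_itv/=.
  by rewrite in_itv/= => jw; exists j.
- rewrite inE.
  rewrite (_ : [set w | _] = \bigcup_(j in [set: 'I_N])
      ((fun w => tnth (psum X m w) j) @^-1` `[m%:R * (p0 / 4), +oo[)).
    apply: fin_bigcup_measurable; first exact: finite_finset.
    move=> j _; rewrite -[X in measurable X]setTI.
    have mX i : measurable_fun setT (X i).
      by apply: measurable_vadd => //; exact: measurable_vscale.
    have := (measurable_fun_tnthP (psum X m)).1 (measurable_psum X m mX) j.
    by move=> /(_ measurableT _ (measurable_itv `[m%:R * (p0 / 4), +oo[)).
  apply/seteqP; split => [w [j jw]|w [j _]] /=.
    by exists j => //=; rewrite in_itv/= andbT.
  by rewrite in_itv/= andbT => jw; exists j.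
move=> w /= [j jw]; exists j.
rewrite tnth_psum.
have -> : \sum_(i < m | (i < m)%N) tnth (X i w) j =
    \sum_(i < m) (\int[P]_w' term (h j) i w' - term (h j) i w).
  by apply: eq_big => [i|i _]; rewrite ?ltn_ord// !vE !tnth_mktuple mulN1r.
rewrite sumrB -/(tent_count (h j) w).
have : m%:R * (p0 / 2) <= \sum_(i < m) \int[P]_w' term (h j) i w'.
  rewrite -[m in leLHS]card_ord -sum1_card natr_sum mulr_suml.
  by apply: ler_sum => i _; rewrite mul1r; exact: tent_term_mean.
by lra.
Qed.

End small_ball.

(** * Typical measurements *)

(** Continuity from above along sets decreasing to the empty set. Any threshold will do, as long as
    it is numerical. *)
Lemma gauss1_tail {R : realType} (e : R) : 0 < e ->
  exists2 K : R, 0 < K & (gauss1 [set x : R | (K < `|x|)%R] <= e%:E)%E.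
Proof.
move=> e0.
pose F (k : nat) : set (measurableTypeR R) := [set x : R | k.+1%:R < `|x|].
have mF k : measurable (F k).
  rewrite (_ : F k = (fun x : R => `|x|) @^-1` `]k.+1%:R, +oo[).
    rewrite -[X in measurable X]setTI.
    by apply: (@normr_measurable R setT) => //; exact: measurable_itv.
  by apply/seteqP; split => x /=; rewrite in_itv/= andbT.
have F0 : \bigcap_k F k = set0.
  apply/seteqP; split => // x Fx; have := Fx (Num.truncn `|x|) I; rewrite /F /=.
  by rewrite ltNge ltW// truncnS_gt.
have dF : {homo F : n m / (n <= m)%N >-> (m <= n)%O}.
  move=> k l kl; apply/subsetPset => x /=; apply: le_lt_trans.
  by rewrite ler_nat ltnS.
have := nonincreasing_cvg_mu (mu := @gauss1 R) _ mF _ dF.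
rewrite F0 measure0 => /(_ _ _)/fine_cvgP H.
have {H}[] := H _ _.
- by rewrite ltey_eq fin_num_measure.
- by [].
move=> _ /cvgrPdist_lt /(_ _ e0)[k _ /(_ k (leqnn k))] /=.
rewrite sub0r normrN => Fe; exists k.+1%:R => //.
have fF : gauss1 (F k) \is a fin_num by exact: fin_num_measure.
rewrite -(fineK fF) lee_fin; apply: le_trans (ltW Fe); exact: ler_norm.
Qed.

(** The integrand of [local_mean_width] is a supremum over an arbitrary set and may fail to be
    measurable; the comparison goes through the supremum over simple functions below. *)
Lemma ge0_le_integralT {d} {T : measurableType d} {R : realType}
    (mu : measure T R) (f g : T -> \bar R) : (forall x, 0 <= f x)%E ->
  (forall x, f x <= g x)%E -> (\int[mu]_x f x <= \int[mu]_x g x)%E.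
Proof.
move=> f0 fg.
rewrite !ge0_integralTE//; last by move=> x; exact: le_trans (f0 x) (fg x).
apply: ereal_sup_le => _ [h hf <-]; exists h => // x.
exact: le_trans (hf x) (fg x).
Qed.

Section outputs.
Context {R : realType} {dS} {S : measurableType dS} (Q : probability S R)
  (f : S -> R -> R) (mf : measurable_fun setT (fun z : S * R => f z.1 z.2)).
Local Notation e := (expected_abs_output Q f).

(* [G] is [|y| < c E|f(g)|] by Markov's inequality; for [E|f(g)| = 0] this would
   be empty, and [y = 0] is used instead. *)
Lemma typical_outputs (c : R) : 0 < c -> exists G : set R,
  [/\ measurable G,
      ((Q \x gauss1) [set z | ~ G (f z.1 z.2)] <= (c^-1)%:E)%E &
      forall (y r : R) (N : \bar R), G y -> 0 <= r ->
        (c%:E * e + r%:E <= N)%E -> (e = 0 -> r%:E < N)%E ->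
        ((`|y| + r)%:E < N)%E].
Proof.
move=> c0.
have mabs : measurable_fun setT (fun z : S * measurableTypeR R => `|f z.1 z.2| : R).
  by apply: measurableT_comp.
have e0 : (0 <= e)%E by apply: integral_ge0 => z _; rewrite lee_fin.
have [eq0|eneq0] := eqVneq e 0%E.
  exists [set 0]; split => //.
  - apply: le_trans (_ : 0 <= _)%E; last by rewrite lee_fin invr_ge0 ltW.
    have mg : measurable_fun setT (fun z : S * measurableTypeR R => (`|f z.1 z.2|%:E)%E).
      exact/measurable_EFinP.
    have : ae_eq (Q \x gauss1)%E setT (fun z => (`|f z.1 z.2|%:E)%E) (cst 0%E).
      apply/(ae_eq_integral_abs _ measurableT mg).
      by rewrite -[RHS]eq0; apply: eq_integral => z _; rewrite gee0_abs// lee_fin.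
    have m0 : measurable [set z : S * measurableTypeR R | ~ [set 0] (f z.1 z.2)].
      have -> : [set z : S * measurableTypeR R | ~ [set 0] (f z.1 z.2)] =
          setT `&` (fun z : S * measurableTypeR R => f z.1 z.2) @^-1` (~` [set 0]).
        by rewrite setTI.
      by apply: mf => //; exact: measurableC.
    move=> [A [mA A0 UA]]; rewrite -A0; apply: le_measure; rewrite ?inE//.
    move=> z /= fz; apply: (UA z) => /= /(_ I) [] /eqP.
    by rewrite normr_eq0 => /eqP.
  - move=> y r N /= -> r0 _ /(_ eq0); by rewrite normr0 add0r.
(* An infinite mean forces [N = +oo], so every output counts as typical. *)
have [eoo|enoo] := eqVneq e +oo%E.
  exists setT; split => //.
  - rewrite (_ : [set _ | _] = set0); last by apply/seteqP; split => // z /=; apply.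
    by rewrite measure0 lee_fin invr_ge0 ltW.
  - move=> y r N _ r0; rewrite eoo gt0_muley ?lte_fin// addye// leye_eq => /eqP -> _.
    exact: ltry.
have fe : e \is a fin_num by rewrite ge0_fin_numE// lt_neqAle enoo leey.
pose e' := fine e.
have eE : e = e'%:E by rewrite /e' fineK.
have e'0 : 0 < e' by rewrite -lte_fin -eE lt_neqAle eq_sym eneq0.
have mU : measurable [set z : S * measurableTypeR R | ~ `|f z.1 z.2| < c * e'].
  rewrite (_ : [set _ | _] = (fun z : S * measurableTypeR R => `|f z.1 z.2|)
      @^-1` `[c * e', +oo[).
    rewrite -[X in measurable X]setTI; apply: mabs => //; exact: measurable_itv.
  by apply/seteqP; split => z /=; rewrite in_itv/= andbT leNgt => /negP.
exists [set y | `|y| < c * e']; split.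
- rewrite (_ : [set _ | _] = (fun x : R => `|x|) @^-1` `]-oo, c * e'[).
    rewrite -[X in measurable X]setTI.
    by apply: (@normr_measurable R setT) => //; exact: measurable_itv.
  by apply/seteqP; split => x /=; rewrite in_itv.
- have mg : measurable_fun setT (fun z : S * measurableTypeR R => (f z.1 z.2)%:E).
    exact/measurable_EFinP.
  have ce0 : 0 < c * e' by rewrite mulr_gt0.
  pose U := [set z : S * measurableTypeR R | ~ `|f z.1 z.2| < c * e'].
  have UE : setT `&` [set z : S * measurableTypeR R | ((c * e')%:E <= `|(f z.1 z.2)%:E|)%E] = U.
    apply/seteqP; split => z /=; rewrite lee_fin.
      by move=> [_]; rewrite leNgt => /negP.
    by move=> /negP; rewrite -leNgt.
  have H : ((c * e')%:E * (Q \x gauss1) U <= e'%:E)%E.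
    rewrite -eE -UE.
    exact: (le_integral_abse (Q \x gauss1)%E measurableT mg ce0).
  suff : ((Q \x gauss1) U <= (c^-1)%:E)%E by [].
  move: H; case: ((Q \x gauss1)%E U) => [u| |].
  - rewrite -EFinM !lee_fin => H.
    by rewrite -(ler_pM2l ce0) (le_trans H)// mulrAC mulfV ?mul1r// gt_eqF.
  - by rewrite gt0_muley ?lte_fin.
  - by rewrite leNye.
- move=> y r N /= yc r0; rewrite eE -EFinM -EFinD => /lt_le_trans H _; apply: H.
  by rewrite lte_fin ltrD2r.
Qed.

End outputs.

Section small_ball_set.
Context {R : realType} {d dS : measure_display} {T : measurableType d}
  {S : measurableType dS} {P : probability T R} {Q : probability S R}
  {m n : nat}.
Variables (a : 'I_m -> T -> 'rV[R]_n) (xi : 'I_m -> T -> S).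
Hypothesis haxi : measurement_ensemble P Q a xi.
Variables (x0 : 'rV[R]_n) (B : set (S * R)).
Hypotheses (hx0 : norm2 x0 = 1) (mB : measurable B).
Local Notation p0 := (@tent_mean R).
Hypothesis PB : ((Q \x gauss1) (~` B) <= (p0 / 2)%:E)%E.
Local Notation count := (tent_count a xi x0 B).

(** The Lipschitz factor depends on [w], which is harmless: the density argument treats one [w] at a
    time. *)
Lemma tent_count_lipschitz (x y : 'rV[R]_n) w :
  count x w <= count y w + \sum_(i < m) \sum_(j < n) `|a i w 0 j| * `|x 0 j - y 0 j|.
Proof.
rewrite -big_split; apply: ler_sum => i _ /=.
have c01 : 0 <= (\1_B (xi i w, dot (a i w) x0) : R) <= 1.
  by rewrite indicE; case: (_ \in _); rewrite ?lexx ?ler01.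
move: c01 => /andP[c0 c1].
rewrite -lerBlDl -mulrBl; apply: le_trans (ler_norm _) _.
rewrite normrM (ger0_norm c0).
apply: le_trans (_ : `|tent (dot (a i w) x) - tent (dot (a i w) y)| <= _).
  by rewrite ler_piMr.
apply: le_trans (tent_lipschitz _ _) _; rewrite -dotBr.
apply: le_trans (ler_norm_sum _ _ _) _; apply: ler_sum => j _.
by rewrite normrM !mxE.
Qed.

Lemma tent_count_dense (h : nat -> 'rV[R]_n) (x : 'rV[R]_n) c w :
  (forall e, 0 < e -> exists k, forall j, `|h k 0 j - x 0 j| < e) ->
  (forall k, c <= count (h k) w) -> c <= count x w.
Proof.
move=> hx hc; apply/ler_addgt0Pr => e e0.
(* The summand 1 makes [M] positive, so that [e / M] is an admissible precision. *)
pose M := 1 + \sum_(i < m) \sum_(j < n) `|a i w 0 j|.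
have M0 : 0 < M by rewrite ltr_wpDr// !sumr_ge0// => i _; rewrite sumr_ge0.
have [k hk] := hx _ (divr_gt0 e0 M0).
apply: le_trans (hc k) _; apply: le_trans (tent_count_lipschitz _ x _) _.
rewrite lerD2l; apply: (@le_trans _ _ (M * (e / M)));
  last by rewrite mulrCA mulfV ?mulr1// gt_eqF.
apply: (@le_trans _ _ ((M - 1) * (e / M))); last first.
  by rewrite ler_wpM2r ?divr_ge0// ?ltW// gtrBl.
rewrite /M addrAC subrr add0r mulr_suml; apply: ler_sum => i _.
rewrite mulr_suml; apply: ler_sum => j _.
by rewrite ler_wpM2l// ltW.
Qed.

(** The finite bound does not depend on the number of directions, so it survives the increasing
    union over initial segments of a dense sequence. The exceptional set is a countable union, hence
    measurable, although [A] may be uncountable. *)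
Lemma small_ball_set {dG} {TG : measurableType dG} (PG : probability TG R)
    (g : TG -> 'rV[R]_n) (A : set 'rV[R]_n) : standard_gaussian PG g ->
  (forall x, A x -> norm2 x = 1) ->
  (forall N (h : 'I_N -> 'rV[R]_n), (forall j, A (h j)) ->
     \int[PG]_w emaxp (gproc h (g w)) <= (Num.sqrt m%:R * (p0 / 32))%:E)%E ->
  exists E : set T, [/\ measurable E,
    ((1 - expR (- (p0 ^+ 2 / 256 * m%:R)))%:E <= P E)%E &
    forall w, E w -> forall x, A x -> m%:R * (p0 / 4) <= count x w].
Proof.
move=> gg A1 width; set eps := expR _.
have [->|/set0P[y0 Ay0]] := eqVneq A set0.
  exists setT; split => //.
  by rewrite probability_setT lee_fin gerBl expR_ge0.
have [h [hA hd]] := dense_sequence A y0 Ay0.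
pose F k := [set w | exists j : 'I_k, (count (h j) w <= m%:R * (p0 / 4))%R].
have mF k : measurable (F k).
  rewrite (_ : F k = \bigcup_(j in [set: 'I_k]) ((count (h j)) @^-1` `]-oo, m%:R * (p0 / 4)])).
    apply: fin_bigcup_measurable; first exact: finite_finset.
    move=> j _; rewrite -[X in measurable X]setTI.
    by apply: (measurable_tent_count a xi haxi x0 B mB (h j));
      [exact: measurableT|exact: measurable_itv].
  apply/seteqP; split => [w [j jw]|w [j _]] /=.
    by exists j => //=; rewrite in_itv/=.
  by rewrite in_itv/= => jw; exists j.
have PF k : (P (F k) <= eps%:E)%E.
  apply: (small_ball_finite a xi haxi x0 B hx0 mB PB (fun j : 'I_k => h j) _ PG g gg).
    by move=> j; exact: A1.
  by apply: width => j; exact: hA.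
have mU : measurable (\bigcup_k F k) by exact: bigcup_measurable.
have ndF : {homo F : k l / (k <= l)%N >-> (k <= l)%O}.
  move=> k l kl; apply/subsetPset => w [j jw].
  by exists (widen_ord kl j).
have PU : (P (\bigcup_k F k) <= eps%:E)%E.
  have cv := nondecreasing_cvg_mu (mu := P) mF mU ndF.
  rewrite -(cvg_lim _ cv)//; apply: lime_le; first by apply/cvg_ex; eexists; exact: cv.
  by apply: nearW => k; exact: PF.
exists (~` (\bigcup_k F k)); split; first exact: measurableC.
- have -> : P (~` (\bigcup_k F k)) = (1 - P (\bigcup_k F k))%E by exact: probability_setC.
  by rewrite EFinB leeB.
- move=> w nw x Ax; apply: (tent_count_dense h).
    by move=> e e0; exact: hd.
  move=> k; rewrite leNgt; apply/negP => lk; apply: nw.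
  by exists k.+1 => //; exists ord_max => /=; exact: ltW.
Qed.

End small_ball_set.

(** [t * maxp] is the maximum of [dot (g w) x] over 0 and the points [t *: h j], all of them in [L]
    and in the ball of radius [t]; [L 0] accounts for the baseline. The dimension bound reads
    [(W / t) ^+ 2 <= M / c]. *)
Lemma width_finite_le {R : realType} {dG} {TG : measurableType dG}
    (PG : probability TG R) {n N : nat} (g : TG -> 'rV[R]_n) (t c M : R)
    (L : set 'rV[R]_n) (h : 'I_N -> 'rV[R]_n) :
  standard_gaussian PG g -> 0 < t -> 0 < c -> 0 <= M -> L 0 ->
  (forall j, L (t *: h j) /\ norm2 (h j) = 1) ->
  (c%:E * local_effective_dimension PG g t L <= M%:E)%E ->
  (\int[PG]_w emaxp (gproc h (g w)) <= (Num.sqrt M * Num.sqrt c^-1)%:E)%E.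
Proof.
move=> gg t0 c0 M0 L0 Lh.
rewrite /local_effective_dimension; set W := local_mean_width _ _ _ _.
set J := (\int[PG]_w _)%E.
have J0 : (0 <= J)%E by apply: integral_ge0 => w _; rewrite lee_fin maxp_ge0.
have mg : measurable_fun setT (fun w => emaxp (gproc h (g w))).
  apply/measurable_EFinP; apply: measurable_maxp; apply: measurable_gproc => j.
  by have [] := gg.1 j.
have JW : (t%:E * J <= W)%E.
  rewrite -ge0_integralZl//; last 2 first.
  - by move=> w _; rewrite lee_fin maxp_ge0.
  - by rewrite lee_fin ltW.
  apply: ge0_le_integralT.
    by move=> w; rewrite mule_ge0// lee_fin ?maxp_ge0// ltW.
  move=> w; rewrite /emaxp -EFinM.
  have [->|[j ->]] := maxp_attained (gproc h (g w)).
    apply: ereal_sup_ubound; exists 0 => /=.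
      by split => //=; rewrite /norm2 /dot big1 ?sqrtr0 ?ltW// => j _; rewrite mxE mul0r.
    rewrite /dot big1 ?mulr0// => j _; by rewrite mxE mulr0.
  apply: ereal_sup_ubound; exists (t *: h j) => /=.
    by split; [exact: (Lh j).1|rewrite norm2Z (Lh j).2 mulr1 ger0_norm// ltW].
  by rewrite dotZr tnth_mktuple.
have W0 : (0 <= W)%E by apply: le_trans JW; rewrite mule_ge0// lee_fin ltW.
move: JW W0 J0; case: W => [v| |]//; last first.
  (* An infinite width makes the effective dimension infinite, against the bound by [M]. *)
  move=> _ _ _; rewrite mulyy gt0_mulye ?lte_fin ?invr_gt0 ?exprn_gt0//.
  by rewrite gt0_muley ?lte_fin.
case: J => [u| |]//; last by rewrite gt0_muley ?lte_fin.
rewrite -!EFinM !lee_fin => uv v0 u0 H.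
rewrite -sqrtrM// -[leLHS]ger0_norm// -sqrtr_sqr ler_sqrt; last first.
  by rewrite mulr_ge0// invr_ge0 ltW.
rewrite ler_pdivlMr//; apply: le_trans H; rewrite mulrC ler_pM2l// ler_pdivlMr ?exprn_gt0//.
by rewrite -exprMn -expr2 ler_pXn2r ?nnegrE ?mulr_ge0 1?mulrC// ltW.
Qed.

(** Convexity where the weight [b] or the tent vanishes, so that curvature is asked for only
    elsewhere; there Taylor applies, with [tent u * b <= u ^+ 2]. *)
Lemma bregman_tent_lower {R : realType} (L : R -> R) (v t u C b : R) :
  convex_function (E := R^o) setT L ->
  (forall x, derivable L x 1) -> (forall x, derivable L^`()%classic x 1) ->
  0 <= C -> 0 <= b <= 1 ->
  (0 < b -> 0 < tent u -> forall x, 0 <= x <= 1 ->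
     C <= L^`()%classic^`()%classic (v + x * (t * u))) ->
  C / 2 * t ^+ 2 * (tent u * b) <= L (v + t * u) - L v - L^`()%classic v * (t * u).
Proof.
move=> cL dL dL' C0 /andP[b0 b1] LC.
have cvx := convex_tangent L v (t * u) cL (dL v).
move: b0; rewrite le_eqVlt => /predU1P[<-|b0]; first by rewrite !mulr0.
have := tent_ge0 u; rewrite le_eqVlt => /predU1P[<-|u0]; first by rewrite mul0r mulr0.
apply: le_trans (taylor2_lower_bound L v (t * u) C dL dL' (LC b0 u0)).
rewrite exprMn [leRHS]mulrA; apply: ler_wpM2l.
  by rewrite mulr_ge0 ?sqr_ge0 ?divr_ge0.
by apply: le_trans (tent_le_sqr u); rewrite ler_piMr// tent_ge0.
Qed.

Lemma norm_coord_le {R : realType} {m : nat} (x : 'rV[R]_m) i : `|x 0 i| <= `|x|.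
Proof.
rewrite [leRHS]mx_normrE.
exact: (le_bigmax _ (fun i : 'I_1 * 'I_m => `|x i.1 i.2|) (0, i)).
Qed.

(** * Restricted strong convexity *)

Lemma measure_bad_measurements {R : realType} {dS} {S : measurableType dS}
    (Q : probability S R) (f : S -> R -> R) (r : R) (G : set R) (e1 e2 : R) :
  measurable_fun setT (fun z : S * R => f z.1 z.2) -> measurable G ->
  (gauss1 [set x : R | (r < `|x|)%R] <= e1%:E)%E ->
  ((Q \x gauss1) [set z | ~ G (f z.1 z.2)] <= e2%:E)%E ->
  let B := [set z : S * R | `|z.2| <= r /\ G (f z.1 z.2)] in
  measurable B /\ ((Q \x gauss1) (~` B) <= (e1 + e2)%:E)%E.
Proof.
move=> mf mG H1 H2 B.
have mV : measurable [set x : measurableTypeR R | r < `|x|].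
  rewrite (_ : [set _ | _] = (fun x : R => `|x|) @^-1` `]r, +oo[).
    rewrite -[X in measurable X]setTI.
    by apply: (@normr_measurable R setT) => //; exact: measurable_itv.
  by apply/seteqP; split => x /=; rewrite in_itv/= andbT.
have mU1 : measurable ([set: S] `*` [set x : measurableTypeR R | r < `|x|]).
  exact: measurableX.
have mU2 : measurable [set z : S * measurableTypeR R | ~ G (f z.1 z.2)].
  rewrite (_ : [set _ | _] = setT `&` (fun z : S * R => f z.1 z.2) @^-1` (~` G)).
    by apply: mf => //; exact: measurableC.
  by rewrite setTI.
have BC : ~` B = ([set: S] `*` [set x : measurableTypeR R | r < `|x|]) `|`
    [set z : S * measurableTypeR R | ~ G (f z.1 z.2)].
  rewrite /B; apply/seteqP; split => z /=.
    move=> /not_andP[/negP|]; last by right.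
    by rewrite -ltNge; left.
  by move=> [[_ rz]|nG] [zr Gz]; [move: rz; rewrite ltNge zr|exact: nG].
have mBC : measurable (~` B) by rewrite BC; exact: measurableU.
split; first by rewrite -[B]setCK; exact: measurableC.
rewrite BC; apply: le_trans (measureU2 (Q \x gauss1)%E mU1 mU2) _.
rewrite EFinD; apply: leeD => //; apply: le_trans H1.
rewrite le_eqVlt; apply/orP; left; apply/eqP.
transitivity (Q setT * gauss1 [set x : R | (r < `|x|)%R])%E.
  exact: product_measure1E.
by rewrite (_ : Q setT = 1%E) ?mul1e//; exact: probability_setT.
Qed.

Theorem theorem2p5 (R : realType) :
  exists (C1 C2 C3 C4 : R) (CRSC : R -> R),
    [/\ 0 < C1, 0 < C2, 0 < C3 & 0 < C4] /\
    (forall c, 0 < c -> 0 < CRSC c) /\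
    forall (m n : nat)
      (* probability space of the measurements; law Q of the seed of f *)
      (d : measure_display) (T : measurableType d) (P : probability T R)
      (dS : measure_display) (S : measurableType dS) (Q : probability S R)
      (* a Gaussian vector g ~ N(0, I_n) used to define d_t *)
      (dG : measure_display) (TG : measurableType dG) (PG : probability TG R)
      (g : TG -> 'rV[R]_n) (hg : standard_gaussian PG g)
      (Y : set R) (hY : closed Y)
      (f : S -> R -> R)
      (mf : measurable_fun setT (fun z : S * R => f z.1 z.2))
      (fY : forall s u, Y (f s u))
      (x0 : 'rV[R]_n) (hx0 : norm2 x0 = 1)
      (a : 'I_m -> T -> 'rV[R]_n) (xi : 'I_m -> T -> S)
      (haxi : measurement_ensemble P Q a xi)
      (yt : T -> 'rV[R]_m) (ytY : forall w i, Y (yt w 0 i))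
      (L : R -> R -> R) (hconv : convex_loss Y L) (hC1 : C1_loss Y L)
      (CL : R) (hCL : 0 < CL) (hLip : lipschitz_dloss Y L CL)
      (mu : R) (hmu : scaling_parameter Q f L mu)
      (K : set 'rV[R]_n) (hK : K (mu *: x0))
      (t : R) (ht : 0 < t)
      (L3 : C2_loss Y L)
      (M N : \bar R) (hM0 : (0 < M)%E) (hN0 : (0 < N)%E)
      (hM : ((Num.max (32 * t) (C1 * `|mu|))%:E <= M)%E)
      (* `|y - y~| is the sup-norm on 'rV_m *)
      (hN : {ae P, forall w,
              (C2%:E * expected_abs_output Q f
               + `|observations f xi a x0 w - yt w|%:E <= N)%E})
      (* degenerate case f(g) = 0 almost surely only: in all other cases hN
         already implies this strict inequality *)
      (hN' : expected_abs_output Q f = 0%E ->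
             {ae P, forall w,
              (`|observations f xi a x0 w - yt w|%:E < N)%E})
      (CMN : R) (hCMN : 0 < CMN) (L4 : d2loss_lower_bound Y L M N CMN)
      (hm : (C3%:E * local_effective_dimension PG g t
                       [set (x - mu *: x0)%R | x in K] <= m%:R%:E)%E),
    exists E : set T,
      [/\ measurable E,
          ((1 - expR (- (C4 * m%:R)))%:E <= P E)%E &
          forall w, E w ->
            restricted_strong_convexity
              (empirical_loss L (fun i => a i w) (yt w))
              K (mu *: x0) t (CRSC CMN)].
Proof.
pose p0 : R := tent_mean.
have p00 : 0 < p0 by exact: tent_mean_gt0.
(* Half of the budget [p0 / 2] for bad measurements goes to large [|dot a x0|]; the other half goes
   to atypical outputs, whence [C2 = 4 / p0]. *)
have [r r0 Hr] := @gauss1_tail R (p0 / 4) (divr_gt0 p00 (ltr0n _ 4)).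
(* [C3] makes the width at most [sqrt m * p0 / 32], [C4] is the rate of [small_ball_set], and
   [c * p0 / 8] is [c / 2] times the count fraction [p0 / 4]. *)
exists (2 * r), (4 / p0), ((32 / p0) ^+ 2), (p0 ^+ 2 / 256), (fun c => c * p0 / 8).
split.
  split; [exact: mulr_gt0|exact: divr_gt0| |].
    by apply: exprn_gt0; exact: divr_gt0.
  exact: (divr_gt0 (exprn_gt0 2 p00) (ltr0n _ 256)).
split; first by move=> c c0; rewrite divr_gt0// mulr_gt0.
move=> m n d T P dS S Q dG TG PG g gg Y hY f mf fY x0 hx0 a xi haxi yt ytY L hconv hC1
  CL hCL hLip mu hmu K hK t t0 L3 M N hM0 hN0 hM hN hN' CMN hCMN L4 hm.
(* For [m = 0] the required probability is 0; the main argument divides by [m]. *)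
have [m0|m0] := posnP m.
  exists set0; split => //.
  by rewrite measure0 m0 mulr0 oppr0 expR0 subrr.
have C20 : 0 < 4 / p0 by rewrite divr_gt0.
have [G [mG PGn HG]] := typical_outputs Q f mf (4 / p0) C20.
have [mB PB0] := measure_bad_measurements Q f r G _ _ mf mG Hr PGn.
set B := [set z : S * R | _] in mB PB0.
have PB : ((Q \x gauss1) (~` B) <= (tent_mean / 2)%:E)%E.
  apply: le_trans PB0 _; rewrite lee_fin invf_div -/p0; lra.
pose z := mu *: x0.
pose A := [set h : 'rV[R]_n | norm2 h = 1 /\ K (z + t *: h)].
have width k (h : 'I_k -> 'rV[R]_n) : (forall j, A (h j)) ->
    (\int[PG]_w emaxp (gproc h (g w)) <= (Num.sqrt m%:R * (tent_mean / 32))%:E)%E.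
  move=> Ah.
  have -> : tent_mean / 32 = Num.sqrt ((32 / p0) ^+ 2)^-1 :> R.
    by rewrite -exprVn sqrtr_sqr invf_div ger0_norm// divr_ge0// ltW.
  apply: (width_finite_le PG g t _ _ [set (x - mu *: x0)%R | x in K]) => //.
  - by rewrite exprn_gt0// divr_gt0.
  - by exists z; rewrite ?subrr.
  - move=> j; have [h1 Kh] := Ah j; split => //.
    by exists (z + t *: h j) => //; rewrite addrC addKr.
have [E0 [mE0 PE0 HE0]] := small_ball_set a xi haxi x0 B hx0 mB PB
  PG g A gg (fun h Ah => Ah.1) width.
pose delta w := `|observations f xi a x0 w - yt w|.
(* One measurable null set for both almost sure hypotheses; the strict one is at hand only when the
   mean output is 0. *)
have [Z [mZ PZ HZ]] : exists Z : set T, [/\ measurable Z, P Z = 0%E &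
    forall w, ~ Z w -> ((4 / p0)%:E * expected_abs_output Q f + (delta w)%:E <= N)%E /\
      (expected_abs_output Q f = 0%E -> ((delta w)%:E < N)%E)].
  have [Z1 [mZ1 PZ1 sZ1]] := hN.
  have [e0|e0] := pselect (expected_abs_output Q f = 0%E).
    have [Z2 [mZ2 PZ2 sZ2]] := hN' e0.
    exists (Z1 `|` Z2); split; first exact: measurableU.
    - by rewrite measureU0.
    - move=> w nZ; split => [|_]; apply: contrapT => H; apply: nZ.
        by left; exact: sZ1.
      by right; exact: sZ2.
  exists Z1; split => // w nZ; split => //.
  by apply: contrapT => H; apply: nZ; exact: sZ1.
exists (E0 `\` Z); split; first exact: measurableD.
  apply: (le_trans PE0).
  apply: (@le_trans _ _ (P ((E0 `\` Z) `|` Z))).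
    apply: le_measure; rewrite ?inE//.
      by apply: measurableU => //; exact: measurableD.
    by move=> w E0w; have [Zw|nZw] := pselect (Z w); [right|left; split].
  apply: le_trans (measureU2 P (measurableD mE0 mZ) mZ) _.
  rewrite -[leRHS]adde0; apply: leeD2l.
  by rewrite le_eqVlt; apply/orP; left; apply/eqP; exact: PZ.
move=> w [E0w nZw] x Kx xt.
have [HN HN0] := HZ w nZw.
have dL i v : derivable (L ^~ (yt w 0 i)) v 1 by have [h _ _] := L3 _ (ytY w i).
have dL' i v : derivable ((L ^~ (yt w 0 i))^`()%classic) v 1.
  by have [_ h _] := L3 _ (ytY w i); exact: h.
rewrite empirical_loss_bregman// xt.
pose h := t^-1 *: (x - z).
have hE : x - z = t *: h by rewrite scalerA mulfV ?scale1r// gt_eqF.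
have Ah : A h.
  split; last by rewrite -hE addrC subrK.
  by rewrite norm2Z xt ger0_norm ?mulVf ?gt_eqF// invr_ge0 ltW.
have cnt := HE0 w E0w h Ah.
have mR0 : 0 < m%:R :> R by rewrite ltr0n.
rewrite [leRHS]mulrC ler_pdivlMr//.
apply: (@le_trans _ _ (CMN / 2 * t ^+ 2 * tent_count a xi x0 B h w)).
  have c0 : 0 <= CMN / 2 * t ^+ 2 by rewrite mulr_ge0 ?sqr_ge0// divr_ge0// ltW.
  apply: le_trans (ler_wpM2l c0 cnt); rewrite le_eqVlt -/p0; apply/orP; left; apply/eqP.
  by field.
rewrite /tent_count mulr_sumr; apply: ler_sum => i _.
rewrite hE (dotZr t).
apply: (bregman_tent_lower (L ^~ (yt w 0 i)) (dot (a i w) z) t (dot (a i w) h) CMN) => //.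
- exact: hconv (ytY w i).
- exact: ltW.
- by rewrite indicE; case: (_ \in _); rewrite ?lexx ?ler01.
move=> b0 u0 tau /andP[tau0 tau1].
have [ra Gy] : B (xi i w, dot (a i w) x0).
  by move: b0; rewrite indicE; case: (boolP (_ \in B)) => [/set_mem//|_]; rewrite ltxx.
have /andP[_ u3] := tent_support _ u0.
set v := (X in _^`()%classic^`()%classic X).
(* On a good measurement with nonzero tent, [|v|] is at most [|mu| r + 3 t]. If this is not below
   [32 t], then [3 t < |mu| r], and it is below [2 r |mu|]; this is the factor 2 in [C1]. *)
have vM : (`|v|%:E < M)%E.
  apply: lt_le_trans hM; rewrite lte_fin.
  have v1 : `|v| <= `|mu| * r + t * 3.
    apply: le_trans (ler_normD _ _) _; rewrite lerD//.
      by rewrite dotZr normrM ler_wpM2l.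
    rewrite !normrM (ger0_norm tau0) (gtr0_norm t0) mulrCA ler_wpM2l ?(ltW t0)//.
    by apply: le_trans (ltW u3); rewrite ler_piMl.
  apply: le_lt_trans v1 _; rewrite lt_max.
  have [H|H] := ltP (`|mu| * r + t * 3) (32 * t); first by [].
  apply/orP; right.
  have : `|mu| * r = r * `|mu| by rewrite mulrC.
  move: H; lra.
(* The actual output differs from the typical ideal one by at most the sup-norm [delta w]. *)
have yN : (`|yt w 0 i|%:E < N)%E.
  apply: le_lt_trans (HG _ (delta w) N Gy (normr_ge0 _) HN HN0); rewrite lee_fin.
  have := norm_coord_le (observations f xi a x0 w - yt w) i.
  rewrite !mxE -/(delta w) => H.
  rewrite -lerBlDl; apply: le_trans H; rewrite distrC; exact: lerB_dist.
have itv (y : R) (M' : \bar R) : (`|y|%:E < M')%E -> (- M' < y%:E < M')%E.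
  move=> yM; apply/andP; split.
    rewrite lteNl -EFinN; apply: le_lt_trans yM; rewrite lee_fin -normrN; exact: ler_norm.
  by apply: le_lt_trans yM; rewrite lee_fin ler_norm.
exact: L4 (itv _ _ vM) (itv _ _ yN) (ytY w i).
Qed.
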